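(* For each $\alpha>1$, there exists a constant $C<\infty$ such that the following holds. Let $f\in L^2(\mathbb P)$ have mean zero and satisfy $$\left|\langle f,e^{-t\mathcal L}f\rangle\right|\le(1+t)^{-\alpha}\quad\text{for every }t\ge0,\qquad \sup_{t\ge1}\mathbf E_{\mathbb P}\left[\left(\frac1{\sqrt t}\int_0^tf(X(s))\,\mathrm ds\right)^4\right]\le1 .$$ For each $t\ge2$ and positive integer $N$, let $$\hat\sigma_1^2(N,t,f):=2\hat\sigma_0^2(N,2t,f)-\hat\sigma_0^2(N,t,f),\quad\text{where}\quad \hat\sigma_0^2(N,t,f):=\frac1N\sum_{k=1}^N\left(\frac1{\sqrt t}\int_0^tf(X^{(k)}(s))\,\mathrm ds\right)^2 .$$ Then $$\mathbf E_{\mathbb P}^{\otimes}\left[\left(\hat\sigma_1^2(N,t,f)-\sigma^2(f)\right)^2\right]^{\frac12}\le C\left(N^{-\frac12}+t^{-(\alpha-1)}\right).$$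
   Context: $(X(t))_{t\ge0}$ is a Feller process on a metric space $\mathcal X$, with laws $(\mathbf P_x)_{x\in\mathcal X}$ and expectations $(\mathbf E_x)$. $\mathbb P$ is a probability measure on $\mathcal X$ (expectation $\mathbb E$) which is invariant for the process; reversibility is not assumed. $\mathbf P_{\mathbb P}$ (expectation $\mathbf E_{\mathbb P}$) is the law of the process started from $\mathbb P$. $\langle f,g\rangle:=\mathbb E[fg]$. $\mathcal L$ is the infinitesimal generator with the sign convention that $(e^{-t\mathcal L})_{t\ge0}$ is the semigroup: $(e^{-t\mathcal L}f)(x)=\mathbf E_x[f(X(t))]$, a contraction on $L^2(\mathbb P)$; the resolvent is $(\lambda+\mathcal L)^{-1}=\int_0^{\infty}e^{-\lambda t}e^{-t\mathcal L}\,\mathrm dt$, $\lambda>0$. Define $\sigma^2(f):=2\lim_{\lambda\to0^+}\langle f,(\lambda+\mathcal L)^{-1}f\rangle$ (the limit exists under the decay assumption in the claim). $X^{(0)},X^{(1)},\dots$ are independent processes, each of law $\mathbf P_{\mathbb P}$; $\mathbf E_{\mathbb P}^{\otimes}$ denotes expectation with respect to their joint law. *)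

(* Defs.v *)
From HB Require Import structures.
From mathcomp Require Import all_boot all_order all_algebra.
From mathcomp Require Import all_classical all_reals all_analysis.

Set Implicit Arguments.
Unset Strict Implicit.
Unset Printing Implicit Defensive.

Import Order.TTheory GRing.Theory Num.Theory.
Import numFieldNormedType.Exports.

Local Open Scope classical_set_scope.
Local Open Scope ring_scope.

(* A measurableType must be pointed; a state space carrying a probability
   measure is nonempty, so asking for a point is no restriction. *)
#[short(type="pmetricType")]
HB.structure Definition PointedMetric (R : numDomainType) :=
  {T of Metric R T & isPointed T}.

Definition borel (R : realType) (T : pmetricType R) :=
  g_sigma_algebraType (@open T).

(* Time is [0, +oo[. Paths are functions on the whole of R, but regularity is
   asked, and events are generated, at nonnegative times only: the values at
   negative times are never observed. *)
Definition cadlag (R : realType) (T : pmetricType R) (w : R -> T) :=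
  forall t, 0 <= t ->
    (w s @[s --> t^'+] --> w t) /\
    (0 < t -> exists l : T, w s @[s --> t^'-] --> l).

Record cadlag_path (R : realType) (T : pmetricType R) := CadlagPath {
  path_fun :> R -> T ;
  path_cadlag : cadlag path_fun }.

Section path_space.
Context (R : realType) (T : pmetricType R).

Lemma cadlag_cst (x : T) : cadlag (fun _ : R => x).
Proof.
by move=> t _; split; [exact: cvg_cst|move=> _; exists x; exact: cvg_cst].
Qed.

HB.instance Definition _ := gen_eqMixin (cadlag_path T).
HB.instance Definition _ := gen_choiceMixin (cadlag_path T).
HB.instance Definition _ :=
  isPointed.Build (cadlag_path T) (CadlagPath (@cadlag_cst point)).

Definition eval_at (t : R) (w : cadlag_path T) : borel T := w t.

(* events {w | w t \in A} with t in I and A a Borel set *)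
Definition events_at (I : set R) : set (set (cadlag_path T)) :=
  \bigcup_(t in I) g_sigma_algebra_preimage (eval_at t).

Definition path_events : set (set (cadlag_path T)) :=
  events_at [set t | 0 <= t].

HB.instance Definition _ := @isMeasurable.Build (sigma_display path_events)
  (cadlag_path T) <<s path_events >>
  (@sigma_algebra0 _ setT path_events) (@sigma_algebraC _ path_events)
  (@sigma_algebra_bigcup _ setT path_events).

End path_space.

Section process.
Context (R : realType) (T : pmetricType R).
Implicit Types (P : R.-pker (borel T) ~> (cadlag_path T))
  (mu : probability (borel T) R) (f g : borel T -> R).

(* (e^{-tL} f)(x) = E_x[f(X(t))], X being the coordinate process *)
Definition semigroup P (t : R) f : borel T -> R :=
  fun x => \int[P x]_w f (w t).

(* (lambda + L)^{-1} f = int_0^oo e^{-lambda t} e^{-tL} f dt *)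
Definition resolvent P (lambda : R) f : borel T -> R :=
  fun x => \int[@lebesgue_measure R]_(t in `[0, +oo[)
    (expR (- (lambda * t)) * semigroup P t f x).

Definition bounded_continuous (g : T -> R) := continuous g /\ bounded_fun g.

(* The space of bounded continuous functions is used since C_0 is meaningful
   only on a locally compact space; the two agree on a compact space. *)
Record feller_process P : Prop := FellerProcess {
  feller_start : forall x : T,
    P x [set w : cadlag_path T | w 0 = x] = 1%E ;
  feller_semigroup : forall t (g : T -> R), 0 <= t ->
    bounded_continuous g -> bounded_continuous (semigroup P t g) ;
  feller_markov : forall (x : T) s t (g : T -> R) (B : set (cadlag_path T)),
    0 <= s -> 0 <= t -> bounded_continuous g -> <<s events_at `[0, s] >> B ->
    \int[P x]_(w in B) g (w (s + t)) =
    \int[P x]_(w in B) semigroup P t g (w s) }.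

Section started_from.
Context mu P.
Local Open Scope ereal_scope.

(* the law of the process started from mu *)
Definition law_from (A : set (cadlag_path T)) : \bar R := \int[mu]_x P x A.

Let law_from0 : law_from set0 = 0.
Proof. by rewrite /law_from integral0_eq. Qed.

Let law_from_ge0 A : 0 <= law_from A.
Proof. exact: integral_ge0. Qed.

Let law_from_sigma_additive : semi_sigma_additive law_from.
Proof.
move=> F mF tF mUF; rewrite [X in _ --> X](_ : _ =
  \int[mu]_x (\sum_(n <oo) P x (F n))); last first.
  apply: eq_integral => x _.
  by apply/esym/cvg_lim => //; exact: measure_semi_sigma_additive.
apply/cvg_closeP; split.
  by apply: is_cvg_nneseries => n _ _; exact: integral_ge0.
rewrite closeE// integral_nneseries// => n.
exact: measurable_kernel.
Qed.

HB.instance Definition _ := isMeasure.Build _ _ _ law_from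
  law_from0 law_from_ge0 law_from_sigma_additive.

Let law_from_setT : law_from [set: _] = 1.
Proof.
rewrite /law_from (eq_integral (cst 1)); last by move=> x _; exact: prob_kernel.
by rewrite integral_cst// mul1e; exact: probability_setT.
Qed.

HB.instance Definition _ :=
  Measure_isProbability.Build _ _ _ law_from law_from_setT.

End started_from.

Definition invariant_law mu P := forall t (A : set (borel T)), 0 <= t ->
  measurable A -> law_from mu P [set w : cadlag_path T | A (w t)] = mu A.

Definition inner mu f g : R := \int[mu]_x (f x * g x).

Definition sigma2 mu P f : R :=
  2 * lim (inner mu f (resolvent P lambda f) @[lambda --> 0^'+]).

Definition normalized_integral f (t : R) (w : cadlag_path T) : R :=
  (Num.sqrt t)^-1 * \int[@lebesgue_measure R]_(s in `[0, t]) f (w s).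

Section estimators.
Context d (Omega : measurableType d) (X : nat -> Omega -> cadlag_path T).

Definition hsigma2_0 (N : nat) (t : R) f (omega : Omega) : R :=
  N%:R^-1 * \sum_(1 <= k < N.+1) normalized_integral f t (X k omega) ^+ 2.

Definition hsigma2_1 (N : nat) (t : R) f (omega : Omega) : R :=
  2 * hsigma2_0 N (2 * t) f omega - hsigma2_0 N t f omega.

End estimators.

End process.

Definition mutually_independent d d' (Omega : measurableType d)
    (E : measurableType d') (R : realType) (Q : probability Omega R)
    (X : nat -> {RV Q >-> E}) :=
  forall (J : seq nat) (A : nat -> set E), uniq J ->
    (forall k, measurable (A k)) ->
    Q (\big[setI/setT]_(k <- J) (X k @^-1` A k)) =
    (\prod_(k <- J) Q (X k @^-1` A k))%E.

(* Main.v *)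
Require Import Defs.
From HB Require Import structures.
From mathcomp Require Import all_boot all_order all_algebra.
From mathcomp Require Import all_classical all_reals all_analysis.
From mathcomp Require Import measurable_realfun giry.
From mathcomp Require Import ring lra.

Set Implicit Arguments.
Unset Strict Implicit.
Unset Printing Implicit Defensive.

Import Order.TTheory GRing.Theory Num.Theory.
Import numFieldNormedType.Exports.

Local Open Scope classical_set_scope.
Local Open Scope ring_scope.

(** Let rho u be the mean of f (X 0) f (X |u|) for the process started from its
    invariant law mu, and let F x be the integral of rho over [0, x].

    Bias. By the Markov property and invariance, f (X s) f (X r) has mean
    rho (s - r) (correlation_two_point). Integrating over s and r in [0, t] and
    using that rho is even, the square of the integral of f (X s) over [0, t]
    has mean twice the integral of F over [0, t] (second_moment_path_integral,
    double_integral_even_kernel). The plain estimator has thus as mean the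
    average of 2 F over [0, t]. Its target is the limit of 2 F at infinity: the
    pairing of f with the resolvent is the Laplace transform of rho
    (inner_resolvent), so dominated convergence gives that sigma2 is twice the
    integral of rho (sigma2_correlation). However fast rho decays, the average
    over [0, t] can remain at a distance of order 1 / t from this limit, because F is not yet close to it for small times. Extrapolation
    removes exactly these times: the mean of the extrapolated estimator is 2 / t
    times the difference of the integrals of F over [0, 2 t] and over [0, t],
    hence the average of 2 F over [t, 2 t], where F differs from its limit by at
    most the tail of (1 + u) `^ (- alpha). This bounds the bias by
    2 / (alpha - 1) * t `^ (- (alpha - 1)) (average_primitive_bias).

    Variance. The N summands are independent copies of
    Y = 2 Z_{2t} ^ 2 - Z_t ^ 2, with Z_t the normalized integral, and
    Y ^ 2 <= 8 Z_{2t} ^ 4 + 2 Z_t ^ 4 has mean at most 10 by the assumption on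
    fourth moments (integral_richardson_sqr_le). The mean square error is
    therefore at most 10 / N plus the squared bias
    (integral_sample_mean_sqr), and taking the square root concludes.

    Two facts about the process underlie this. Right-continuity of the paths
    makes (s, w) |-> w s jointly measurable (measurable_eval), without which time
    integrals could not be exchanged with expectations. And the Markov property,
    stated for bounded continuous functions, determines the joint law of the
    states at two times on all Borel sets (two_point_law_stationary), hence
    applies to the square-integrable f. *)

(** * Real-valued integrals and Fubini *)

Section fine_integrals.
Context d (T : measurableType d) (R : realType).
Variable m : {measure set T -> \bar R}.

Lemma measurable_fine (D : set T) (F : T -> \bar R) :
  measurable_fun D F -> measurable_fun D (fine \o F).
Proof. by move=> mF; apply: measurableT_comp => //; exact: fine_measurable. Qed.

Lemma integrable_fine (D : set T) (F : T -> \bar R) : measurable D ->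
  m.-integrable D F -> m.-integrable D (EFin \o (fine \o F)).
Proof.
move=> mD iF; apply: (le_integrable mD _ _ iF).
  by apply/measurable_EFinP; exact: measurable_fine (measurable_int m iF).
by move=> x _ /=; case: (F x) => [r| |]//=; rewrite ?normr0 ?leey.
Qed.

Lemma integral_fine (D : set T) (F : T -> \bar R) : measurable D ->
  m.-integrable D F ->
  (\int[m]_(x in D) (fine (F x))%:E = \int[m]_(x in D) F x)%E.
Proof.
move=> mD iF; have mF := measurable_int m iF.
apply: ae_eq_integral => //.
  by apply/measurable_EFinP; exact: measurable_fine.
have := integrable_ae mD iF.
by apply: filterS => x h Dx; rewrite fineK// h.
Qed.

(** From 2 |f g| <= f ^ 2 + g ^ 2. *)
Lemma integrable_prod_sqr (D : set T) (f g : T -> R) : measurable D ->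
  measurable_fun D f -> measurable_fun D g ->
  m.-integrable D (fun x => (f x ^+ 2)%:E) ->
  m.-integrable D (fun x => (g x ^+ 2)%:E) ->
  m.-integrable D (fun x => (f x * g x)%:E).
Proof.
move=> mD mf mg if2 ig2.
apply: (le_integrable mD _ _ (integrableD mD if2 ig2)).
  by apply/measurable_EFinP; exact: measurable_funM.
move=> x _ /=; rewrite lee_fin (@ger0_norm _ (_ + _)) ?addr_ge0 ?sqr_ge0//.
rewrite normrM -(normr_id (f x)) -(normr_id (g x)).
rewrite -(real_normK (num_real (f x))) -(real_normK (num_real (g x))) !normr_id.
have := sqr_ge0 (`|f x| - `|g x|); have := normr_ge0 (f x).
by have := normr_ge0 (g x); nra.
Qed.

Lemma ae_eq_Rintegral (f g : T -> R) :
  measurable_fun setT f -> measurable_fun setT g ->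
  {ae m, forall x, f x = g x} -> \int[m]_x f x = \int[m]_x g x.
Proof.
move=> mf mg fg; congr fine; apply: ae_eq_integral => //; try exact/measurable_EFinP.
by apply: filterS fg => x + _ => ->.
Qed.

(** The positive and negative parts swap; when one of their integrals is
    infinite both sides are 0, the value that fine gives to +oo and to -oo. *)
Lemma RintegralN (D : set T) (f : T -> R) :
  \int[m]_(x in D) (- f x) = - \int[m]_(x in D) f x.
Proof.
rewrite /Rintegral integralE [in RHS]integralE.
have -> : (fun x => (- f x)%:E) = (\- (EFin \o f))%E by [].
rewrite funeposN funenegN.
have : (0 <= \int[m]_(x in D) (EFin \o f)^\+ x)%E by exact: integral_ge0.
have : (0 <= \int[m]_(x in D) (EFin \o f)^\- x)%E by exact: integral_ge0.
move: (\int[m]_(x in D) _)%E (\int[m]_(x in D) _)%E => [a| |] [b| |]//= _ _.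
all: by rewrite ?oppr0// opprB.
Qed.

(** Holds for divergent integrals too, so that under Fubini a constant can be
    moved in or out of an inner integral for every value of the outer variable,
    including the null set of those for which the integral diverges. *)
Lemma RintegralZl_measurable (D : set T) (f : T -> R) (c : R) : measurable D ->
  measurable_fun D f -> \int[m]_(x in D) (c * f x) = c * \int[m]_(x in D) f x.
Proof.
move=> mD mf.
have pos r : 0 <= r -> \int[m]_(x in D) (r * f x) = r * \int[m]_(x in D) f x.
  move=> r0; rewrite /Rintegral integralE [in RHS]integralE.
  have -> : (fun x => (r * f x)%:E) = (fun x => r%:E * (EFin \o f) x)%E.
    by apply/funext => x; rewrite EFinM.
  rewrite (ge0_funeposM _ r0) (ge0_funenegM _ r0).
  have mF : measurable_fun D (EFin \o f) by exact/measurable_EFinP.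
  rewrite !ge0_integralZl//; [|exact: measurable_funeneg|exact: measurable_funepos].
  have : (0 <= \int[m]_(x in D) (EFin \o f)^\+ x)%E by exact: integral_ge0.
  have : (0 <= \int[m]_(x in D) (EFin \o f)^\- x)%E by exact: integral_ge0.
  move: r0; rewrite le_eqVlt => /predU1P[<-|r0]; first by rewrite !mul0e sube0 mul0r.
  move: (\int[m]_(x in D) _)%E (\int[m]_(x in D) _)%E => [a| |] [b| |]//= _ _;
    rewrite ?gt0_muley ?lte_fin//= ?mulr0// mulrBr//.
have [c0|c0] := leP 0 c; first exact: pos.
have -> : c = - (- c) by rewrite opprK.
rewrite mulNr -pos ?oppr_ge0 ?ltW// -RintegralN.
by apply: eq_Rintegral => x _; rewrite mulNr.
Qed.

End fine_integrals.

Section real_fubini.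
Context d1 d2 (T1 : measurableType d1) (T2 : measurableType d2) (R : realType).
Variable m1 : {sigma_finite_measure set T1 -> \bar R}.
Variable m2 : {sigma_finite_measure set T2 -> \bar R}.
Variables (D : set T1) (f : T1 * T2 -> R).
Hypothesis mD : measurable D.
Hypothesis mf : measurable_fun setT f.

(* Extending f by 0 outside of D `*` setT reduces to integrals over the whole
   product. *)
Let g : T1 * T2 -> \bar R := (EFin \o f) \_ (D `*` setT).

Let mg : measurable_fun setT g.
Proof.
apply/(measurable_restrictT (EFin \o f)); first exact: measurableX.
by apply: measurable_funTS; exact/measurable_EFinP.
Qed.

Let gx x : (fun y => g (x, y)) = if x \in D then fun y => (f (x, y))%:E else cst 0%E.
Proof.
apply/funext => y; rewrite /g /patch; case: ifPn => [/set_mem[/= xD _]|xD].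
  by rewrite mem_set.
rewrite ifF//; apply/negbTE; apply: contra xD => /set_mem xD.
by apply/mem_set; split.
Qed.

Let gy y : (fun x => g (x, y)) = (fun x => (f (x, y))%:E) \_ D.
Proof.
by apply/funext => x; rewrite [LHS](congr1 (fun h => h y) (gx x)) /patch; case: ifP.
Qed.

Let mfy y : measurable_fun setT (fun x => f (x, y)).
Proof. exact: measurableT_comp. Qed.

Let mfx x : measurable_fun setT (fun y => f (x, y)).
Proof. exact: measurableT_comp. Qed.

Lemma measurable_Rintegral_param :
  measurable_fun setT (fun y => \int[m1]_(x in D) f (x, y)).
Proof.
rewrite /Rintegral; apply: measurable_fine.
have -> : (fun y => \int[m1]_(x in D) (f (x, y))%:E)%E = 
  (fubini_G m1 g^\+ \- fubini_G m1 g^\-)%E.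
  apply/funext => y; rewrite integral_mkcond integralE /fubini_G.
  by rewrite -gy; congr (_ - _)%E; apply: eq_integral => x _; rewrite ?funeposE ?funenegE.
by apply: emeasurable_funB; apply: measurable_fun_fubini_tonelli_G => //;
  [exact: measurable_funepos|exact: measurable_funeneg].
Qed.

Lemma integrable_prodX :
  (\int[m1]_(x in D) \int[m2]_y `|f (x, y)|%:E < +oo)%E ->
  (m1 \x m2)%E.-integrable (D `*` setT) (EFin \o f).
Proof.
move=> fin; apply/integrable_mkcond; first exact: measurableX.
apply/integrable12ltyP => //; apply: le_lt_trans fin.
rewrite [leRHS]integral_mkcond; apply: ge0_le_integral => //.
- by move=> x _; exact: integral_ge0.
- apply: (measurable_fun_fubini_tonelli_F (abse \o g)) => //=.
  exact: measurableT_comp.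
- apply/(measurable_restrictT _ mD); apply: measurable_funTS.
  apply: (measurable_fun_fubini_tonelli_F (fun z => `|f z|%:E)) => //.
  by apply/measurable_EFinP; exact: measurableT_comp.
move=> x _ /=; rewrite [leRHS]patchE -/g.
have gxy y := congr1 (fun h => h y) (gx x).
under eq_integral do rewrite gxy.
by case: ifPn => // _; rewrite integral0_eq// => y _; rewrite abse0.
Qed.

(** The form in which integrability is checked below: an estimate of the
    inner integral that is uniform, or explicit, in the time variable. *)
Lemma integrable_prodX_dominated (b : T1 -> R) : m1.-integrable D (EFin \o b) ->
  (forall x, D x -> (\int[m2]_y `|f (x, y)|%:E <= (b x)%:E)%E) ->
  (m1 \x m2)%E.-integrable (D `*` setT) (EFin \o f).
Proof.
move=> ib fb; apply: integrable_prodX.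
apply: le_lt_trans (integrable_lty mD ib).
apply: ge0_le_integral => //.
- by move=> x _; exact: integral_ge0.
- apply: measurable_funTS.
  apply: (measurable_fun_fubini_tonelli_F (fun z => `|f z|%:E)) => //.
  by apply/measurable_EFinP; exact: measurableT_comp.
- exact: measurable_int ib.
Qed.

Lemma measurable_integral_abs_param :
  measurable_fun setT (fun y => \int[m1]_(x in D) `|f (x, y)|%:E)%E.
Proof.
have mag : measurable_fun setT (abse \o g) by exact: measurableT_comp.
have := @measurable_fun_fubini_tonelli_G _ _ _ _ _ m1 _ mag (fun=> abse_ge0 _).
congr measurable_fun; apply/funext => y; rewrite /fubini_G [RHS]integral_mkcond.
apply: eq_integral => x _ /=.
have /(congr1 (fun h => h x)) /= -> := gy y.
by rewrite !patchE; case: ifP => //= _; rewrite [LHS]abse0.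
Qed.

Lemma integrable_prodX_swapP :
  (m1 \x m2)%E.-integrable (D `*` setT) (EFin \o f) <->
  (\int[m2]_y \int[m1]_(x in D) `|f (x, y)|%:E < +oo)%E.
Proof.
have E : (\int[m2]_y \int[m1]_x `|g (x, y)| =
    \int[m2]_y \int[m1]_(x in D) `|f (x, y)|%:E)%E.
  apply: eq_integral => y _; rewrite [RHS]integral_mkcond; apply: eq_integral => x _.
  have /(congr1 (fun h => h x)) /= -> := gy y.
  by rewrite !patchE; case: ifP => //= _; rewrite [LHS]abse0.
rewrite -E -(integrable21ltyP _ _ mg); split => h.
  exact: (integrable_mkcond (EFin \o f) (measurableX mD measurableT)).1.
exact: (integrable_mkcond (EFin \o f) (measurableX mD measurableT)).2.
Qed.

Hypothesis intf : (m1 \x m2)%E.-integrable (D `*` setT) (EFin \o f).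

Let ig : (m1 \x m2)%E.-integrable setT g.
Proof. exact/(integrable_mkcond (EFin \o f) (measurableX mD measurableT)). Qed.

Let FE : fubini_F m2 g = (fun x => \int[m2]_y (f (x, y))%:E)%E \_ D.
Proof.
apply/funext => x; rewrite /fubini_F gx /patch; case: ifP => // _.
exact: integral0.
Qed.

Let GE : fubini_G m1 g = (fun y => \int[m1]_(x in D) (f (x, y))%:E)%E.
Proof. by apply/funext => y; rewrite /fubini_G gy -integral_mkcond. Qed.

Let iF : m1.-integrable D (fun x => \int[m2]_y (f (x, y))%:E)%E.
Proof. by apply/integrable_mkcond => //; rewrite -FE; exact: integrable_fubini_F. Qed.

Let iG : m2.-integrable setT (fun y => \int[m1]_(x in D) (f (x, y))%:E)%E.
Proof.
rewrite -GE; have igG : m2.-integrable setT (fun y => \int[m1]_x `|g (x, y)|)%E.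
  apply/integrableP; split.
    apply: (measurable_fun_fubini_tonelli_G (abse \o g)) => //=.
    exact: measurableT_comp.
  under eq_integral do rewrite gee0_abs ?integral_ge0//.
  by apply/(integrable21ltyP _ _ mg).
apply: (le_integrable measurableT _ _ igG).
  exact: measurable_fubini_G ig.
move=> y _; rewrite [leRHS]gee0_abs ?integral_ge0//.
by apply: le_abse_integral => //; exact: measurableT_comp.
Qed.

Lemma integrable_Rintegral2 :
  m2.-integrable setT (fun y => (\int[m1]_(x in D) f (x, y))%:E).
Proof. exact: integrable_fine. Qed.

Lemma Rintegral_fubini :
  \int[m1]_(x in D) \int[m2]_y f (x, y) = \int[m2]_y \int[m1]_(x in D) f (x, y).
Proof.
rewrite /Rintegral; congr fine; rewrite !integral_fine//.
by rewrite integral_mkcond -FE -GE; exact: Fubini.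
Qed.

End real_fubini.

(** * Integration along maps with the same image law *)

Section equality_in_law.
Context d1 d2 d (X1 : measurableType d1) (X2 : measurableType d2)
  (Y : measurableType d) (R : realType).
Variables (m1 : {measure set X1 -> \bar R}) (m2 : {measure set X2 -> \bar R}).
Variables (p1 : X1 -> Y) (p2 : X2 -> Y).
Hypotheses (mp1 : measurable_fun setT p1) (mp2 : measurable_fun setT p2).

Let q1 : {mfun X1 >-> Y} := HB.pack p1 (isMeasurableFun.Build _ _ _ _ _ mp1).
Let q2 : {mfun X2 >-> Y} := HB.pack p2 (isMeasurableFun.Build _ _ _ _ _ mp2).

(** Comparing two maps, instead of a map with a given measure, covers at once
    stationarity (two maps on the same path space) and invariance or
    independence (p2 = id, m2 the expected law). *)
Lemma same_law_generated (G : set (set Y)) :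
  @measurable _ Y = <<s G >> -> setI_closed G -> G setT -> (m1 setT < +oo)%E ->
  (forall A, G A -> m1 (p1 @^-1` A) = m2 (p2 @^-1` A)) ->
  forall A, measurable A -> m1 (p1 @^-1` A) = m2 (p2 @^-1` A).
Proof.
move=> mG IG GT fin h A mA.
apply: (@measure_unique _ _ _ G (fun=> setT) mG IG _ _
  (pushforward m1 q1) (pushforward m2 q2)) => //.
by apply/seteqP; split => // x _; exists 0%N.
Qed.

Hypothesis same_law :
  forall A, measurable A -> m1 (p1 @^-1` A) = m2 (p2 @^-1` A).

Lemma ge0_integral_same_law (F : Y -> \bar R) : (forall y, 0 <= F y)%E ->
  measurable_fun setT F ->
  (\int[m1]_x F (p1 x) = \int[m2]_x F (p2 x))%E.
Proof.
move=> F0 mF.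
have := @ge0_integral_pushforward _ _ _ _ R p1 mp1 m1 setT F measurableT mF.
rewrite preimage_setT => <-; last by move=> y _; exact: F0.
have := @ge0_integral_pushforward _ _ _ _ R p2 mp2 m2 setT F measurableT mF.
rewrite preimage_setT => <-; last by move=> y _; exact: F0.
apply: (@eq_measure_integral _ _ _ _ (pushforward m2 q2) (pushforward m1 q1)).
by move=> A mA _; exact: same_law.
Qed.

Lemma integrable_same_law (F : Y -> \bar R) : measurable_fun setT F ->
  m2.-integrable setT (F \o p2) -> m1.-integrable setT (F \o p1).
Proof.
move=> mF /integrableP[_ fin]; apply/integrableP; split.
  exact: measurableT_comp.
have mabsF : measurable_fun setT (abse \o F) by exact: measurableT_comp.
by rewrite (ge0_integral_same_law _ mabsF)// => y; exact: abse_ge0.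
Qed.

(** The positive and negative parts of f have the same integrals on the two
    sides, be they finite or not. *)
Lemma Rintegral_same_law (f : Y -> R) : measurable_fun setT f ->
  \int[m1]_x f (p1 x) = \int[m2]_x f (p2 x).
Proof.
move=> mf; have mF : measurable_fun setT (EFin \o f) by exact/measurable_EFinP.
have E d' (X : measurableType d') (m : {measure set X -> \bar R}) (p : X -> Y) :
    (\int[m]_x (f (p x))%:E =
     \int[m]_x (EFin \o f)^\+ (p x) - \int[m]_x (EFin \o f)^\- (p x))%E.
  rewrite integralE -[fun x => (f (p x))%:E]/((EFin \o f) \o p).
  by rewrite funepos_comp funeneg_comp.
rewrite /Rintegral !E (ge0_integral_same_law _ (measurable_funepos mF))//.
by rewrite (ge0_integral_same_law _ (measurable_funeneg mF)).
Qed.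

End equality_in_law.

Lemma bounded_integrable d (T : measurableType d) (R : realType)
    (m : {finite_measure set T -> \bar R}) (D : set T) (f : T -> R) (M : R) :
  measurable D -> measurable_fun D f -> (forall x, `|f x| <= M) ->
  m.-integrable D (EFin \o f).
Proof.
move=> mD mf fM; apply: (@le_integrable _ _ _ _ _ mD _ (EFin \o cst M)).
- exact/measurable_EFinP.
- by move=> x _ /=; rewrite lee_fin (le_trans (fM x))// ler_norm.
- exact: finite_measure_integrable_cst.
Qed.

Lemma measurable_prod_rectangles d1 d2 (T1 : measurableType d1) (T2 : measurableType d2) :
  @measurable _ (T1 * T2)%type =
  <<s [set A `*` B | A in @measurable _ T1 & B in @measurable _ T2] >>.
Proof. by rewrite measurable_prod_measurableType. Qed.

Lemma setI_closed_rectangles d1 d2 (T1 : measurableType d1) (T2 : measurableType d2) :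
  setI_closed [set A `*` B | A in @measurable _ T1 & B in @measurable _ T2].
Proof.
move=> _ _ [A1 mA1 [B1 mB1 <-]] [A2 mA2 [B2 mB2 <-]].
exists (A1 `&` A2); first exact: measurableI.
by exists (B1 `&` B2); [exact: measurableI|rewrite setXI].
Qed.

(** * Joint measurability of (s, w) |-> w s on cadlag paths *)

Section bounded_continuous_functions.
Context (R : realType) (T : pmetricType R).

Lemma bounded_fun_le (g : T -> R) (M : R) :
  (forall x, `|g x| <= M) -> bounded_fun g.
Proof.
move=> gM; exists M; split; first exact: num_real.
by move=> r Mr x _; exact: le_trans (gM x) (ltW Mr).
Qed.

(** Take min (1, n dist(x, ~` G)). This is what lets the Feller and Markov
    properties, stated for bounded continuous functions, reach Borel sets in an
    arbitrary metric space. *)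
Lemma open_indic_approx (G : set T) : open G ->
  exists g : nat -> T -> R, [/\ forall n, bounded_continuous (g n),
    forall n x, 0 <= g n x <= 1 &
    forall x, g n x @[n --> \oo] --> (\1_G x : R)].
Proof.
move=> oG; have [->|GT] := eqVneq G setT.
  exists (fun _ _ => 1); split.
  - move=> n; split; first by move=> x; exact: cvg_cst.
    by apply: (@bounded_fun_le _ 1) => x; rewrite normr1.
  - by move=> n x; rewrite ler01 lexx.
  - by move=> x; rewrite indicT; exact: cvg_cst.
have /set0P[a Aa] : ~` G != set0.
  by apply: contra GT => /eqP h; rewrite -(setCK G) h setC0.
pose d x : R := fine (edist_inf (~` G) x).
have dfin x : edist_inf (~` G) x \is a fin_num.
  rewrite ge0_fin_numE ?edist_inf_ge0//.
  apply: (@le_lt_trans _ _ (mdist x a + 1)%:E); last exact: ltry.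
  apply: (@le_trans _ _ (edist (x, a))).
    by apply: ereal_inf_lbound; exists a.
  apply: edist_fin => /=; first by rewrite ltr_wpDl// mdist_ge0.
  by rewrite ballEmdist/= ltrDl.
have d0 x : 0 <= d x by rewrite fine_ge0// edist_inf_ge0.
have cd : continuous d.
  move=> x; apply: fine_cvg; rewrite fineK//; exact: edist_inf_continuous.
have dG x : ~ G x -> d x = 0 by move=> Gx; rewrite /d edist_inf0.
have dgt0 x : G x -> 0 < d x.
  move=> Gx; have /nbhs_ballP[e e0 eG] : nbhs x G by exact: open_nbhs_nbhs.
  have e0' : 0 < e := e0.
  suff : (e%:E <= edist_inf (~` G) x)%E.
    by rewrite -(fineK (dfin x)) lee_fin; exact: lt_le_trans.
  apply: le_ereal_inf_tmp => _ [b Gb <-]; rewrite leNgt; apply/negP.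
  by move/edist_lt_ball => /= /eG.
exists (fun n x => Num.min 1 (n%:R * d x)); split.
- move=> n; split.
    move=> x; apply: (@continuous_min _ _ (fun=> 1) (fun x => n%:R * d x)).
      exact: cvg_cst.
    by apply: cvgM; [exact: cvg_cst|exact: cd].
  apply: (@bounded_fun_le _ 1) => x.
  by rewrite ger0_norm ?ge_min ?lexx// le_min ler01 mulr_ge0.
- by move=> n x; rewrite ge_min lexx le_min ler01 mulr_ge0.
- move=> x; have [Gx|Gx] := pselect (G x); rewrite indicE.
    rewrite mem_set//; apply: cvg_near_cst; near=> n.
    apply: min_l; rewrite -ler_pdivrMr ?dgt0//.
    by near: n; exact: nbhs_infty_ger.
  rewrite memNset//; apply: cvg_near_cst; apply: nearW => n.
  by rewrite dG// mulr0; apply: min_r; exact: ler01.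
Unshelve. all: by end_near. Qed.

Lemma continuous_borel_measurable (g : T -> R) : continuous g ->
  measurable_fun [set: borel T] (g : borel T -> R).
Proof.
move=> cg; apply: (measurability _ (RGenOpens.measurableE R)).
move=> _ [_ [a [b ->]] <-]; rewrite setTI.
apply: sub_sigma_algebra; apply: open_comp; last exact: interval_open.
by move=> x _; exact: cg.
Qed.

End bounded_continuous_functions.

Section evaluation.
Context (R : realType) (T : pmetricType R).
Local Notation path := (cadlag_path T).

Lemma measurable_eval_at (t : R) : 0 <= t ->
  measurable_fun [set: path] (eval_at t).
Proof.
move=> t0 _ A mA; apply: sub_sigma_algebra.
by exists t => //; exists A.
Qed.

(* The first point of the grid Z / (n + 1) strictly to the right of s: being to
   the right is what makes right-continuity applicable, and for a fixed n only
   countably many evaluations are involved. *)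
Let grid (n : nat) (s : R) : R :=
  (Num.truncn (n.+1%:R * Num.max 0 s)).+1%:R / n.+1%:R.

Let measurable_truncn_eq n k :
  measurable [set s : R | Num.truncn (n.+1%:R * Num.max 0 s) = k].
Proof.
rewrite (_ : [set _ | _] =
    (fun s : R => n.+1%:R * Num.max 0 s) @^-1` [set` `[k%:R, k.+1%:R[]).
  rewrite -[X in measurable X]setTI.
  suff: measurable_fun setT (fun s : R => n.+1%:R * Num.max 0 s) by apply.
  by apply: measurable_funM => //; exact: measurable_maxr.
apply/seteqP; split => s /=; rewrite in_itv/=.
  by move=> <-; apply: truncn_itv; rewrite mulr_ge0// le_max lexx.
by move/truncn_def.
Qed.

Let measurable_eval_grid (g : borel T -> R) n : measurable_fun setT g ->
  measurable_fun [set: R * path] (fun z => g (z.2 (grid n z.1))).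
Proof.
move=> mg _ B mB; rewrite setTI.
rewrite (_ : _ @^-1` B =
  \bigcup_k ([set s : R | Num.truncn (n.+1%:R * Num.max 0 s) = k] `*`
     [set w : path | B (g (w (k.+1%:R / n.+1%:R)))])).
  apply: bigcupT_measurable => k; apply: measurableX => //.
  have := measurableT_comp mg (@measurable_eval_at (k.+1%:R / n.+1%:R) _).
  by move=> /(_ (ltac:(by rewrite divr_ge0)) measurableT B mB); rewrite setTI.
apply/seteqP; split => [[s w]/= Bs|[s w] /= [k _ [/= <- //]]].
by exists (Num.truncn (n.+1%:R * Num.max 0 s)).
Qed.

Let grid_cvg s : (forall n, grid n s > Num.max 0 s) /\
  grid n s @[n --> \oo] --> Num.max 0 s.
Proof.
set m := Num.max 0 s.
have nm0 n : 0 <= n.+1%:R * m by rewrite mulr_ge0// le_max lexx.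
have lo n : m < grid n s.
  rewrite /grid ltr_pdivlMr// mulrC.
  by have /andP[] := truncn_itv (nm0 n).
split=> //; have up n : grid n s <= m + n.+1%:R^-1.
  rewrite /grid ler_pdivrMr// mulrDl mulVf// -natr1 lerD2r (mulrC m).
  by have /andP[] := truncn_itv (nm0 n).
apply: (@squeeze_cvgr _ _ _ _ (fun=> m) (fun n => m + n.+1%:R^-1)).
- by apply: nearW => n; rewrite up ltW// lo.
- exact: cvg_cst.
- rewrite -[X in _ --> X]addr0; apply: cvgD; first exact: cvg_cst.
  exact: cvg_harmonic.
Qed.

Lemma measurable_eval_continuous (g : T -> R) : continuous g ->
  measurable_fun [set: R * path] (fun z => g (z.2 (Num.max 0 z.1))).
Proof.
move=> cg; pose h n (z : R * path) := g (z.2 (grid n z.1)).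
apply: (@measurable_fun_cvg _ _ _ _ h).
  by move=> n; apply: measurable_eval_grid; exact: continuous_borel_measurable.
move=> [s w] _ /=; have [lo cv] := grid_cvg s.
have m0 : 0 <= Num.max 0 s by rewrite le_max lexx.
have [wr _] := path_cadlag w m0.
have : g (w u) @[u --> (Num.max 0 s)^'+] --> g (w (Num.max 0 s)).
  by apply: cvg_comp wr _; exact: cg.
by move/(cvg_at_rightP (fun u => g (w u))); apply.
Qed.

(** Negative times are sent to 0, since events constrain the path at
    nonnegative times only. As T need not be separable, preimages of open sets
    are recovered from real-valued limits through open_indic_approx. *)
Lemma measurable_eval :
  measurable_fun [set: R * path] (fun z => eval_at (Num.max 0 z.1) z.2).
Proof.
apply: (@measurability _ _ (R * path)%type (borel T) _ _ (@open T)) => //.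
move=> _ [G oG <-]; rewrite setTI; have [g [bcg _ gG]] := open_indic_approx oG.
have mG : measurable_fun [set: R * path]
    (fun z => (\1_G (z.2 (Num.max 0 z.1)) : R)).
  pose h n (z : R * path) := g n (z.2 (Num.max 0 z.1)).
  apply: (@measurable_fun_cvg _ _ _ _ h).
    by move=> n; apply: measurable_eval_continuous; case: (bcg n).
  by move=> z _; exact: gG.
have := mG measurableT [set 1] (measurable_set1 1); rewrite setTI.
congr measurable; apply/seteqP; split => z /=; rewrite indicE.
  by case: (boolP (_ \in G)) => [/set_mem//|_ /eqP]; rewrite eq_sym oner_eq0.
by move=> Gz; rewrite mem_set.
Qed.

End evaluation.

(** * Integration against the law started from mu *)

Section integration_from_initial_law.
Context (R : realType) (T : pmetricType R).
Variables (P : R.-pker (borel T) ~> (cadlag_path T)) (mu : probability (borel T) R).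
Local Notation path := (cadlag_path T).

(** The same measure as P x, as a probability: Fubini on time and paths asks
    for a sigma-finite measure. *)
Definition path_law (x : borel T) : set path -> \bar R := P x.

HB.instance Definition _ x := Measure.on (path_law x).

HB.instance Definition _ x :=
  Measure_isProbability.Build _ _ _ (path_law x) (prob_kernel x).

Lemma measurable_integral_kernel (g : path -> \bar R) :
  (forall w, 0 <= g w)%E -> measurable_fun setT g ->
  measurable_fun setT (fun x => \int[P x]_w g w)%E.
Proof.
move=> g0 mg; apply: measurable_fun_integral_kernel => // U mU.
exact: measurable_kernel.
Qed.

(** The law started from mu is the bind of mu and P in the Giry monad. *)
Lemma ge0_integral_law_from (g : path -> \bar R) :
  (forall w, 0 <= g w)%E -> measurable_fun setT g ->
  (\int[law_from mu P]_w g w = \int[mu]_x \int[P x]_w g w)%E.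
Proof.
move=> g0 mg.
pose k : borel T -> giry path R := fun x => path_law x.
have mk : measurable_fun [set: borel T] k.
  apply: measurable_giry_codensity => // B mB; exact: measurable_kernel.
rewrite -[RHS](@giry_int_bind _ _ _ _ _ mu k mk g mg g0) /giry_int.
apply: eq_measure_integral => A mA _.
rewrite /giry_bind /= [RHS](@giry_int_map _ _ _ _ _ _ mk mu (fun m => m A)) //.
exact: measurable_giry_ev.
Qed.

Lemma ae_lty_path_law (h : path -> \bar R) : (forall w, 0 <= h w)%E ->
  measurable_fun setT h -> (\int[law_from mu P]_w h w < +oo)%E ->
  {ae mu, forall x, (\int[P x]_w h w < +oo)%E}.
Proof.
move=> h0 mh fin.
have : mu.-integrable setT (fun x => \int[P x]_w h w)%E.
  apply/integrableP; split; first exact: measurable_integral_kernel.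
  under eq_integral do rewrite gee0_abs ?integral_ge0//.
  by rewrite -ge0_integral_law_from.
move/integrable_ae => /(_ measurableT); apply: filterS => x /(_ I) fx.
by rewrite -ge0_fin_numE// integral_ge0.
Qed.

Lemma measurable_Rintegral_kernel (g : path -> R) : measurable_fun setT g ->
  measurable_fun setT (fun x => \int[P x]_w g w).
Proof.
move=> mg; apply: measurable_fine.
have mG : measurable_fun setT (EFin \o g) by exact/measurable_EFinP.
rewrite (_ : (fun _ => _) = (fun x => \int[P x]_w (EFin \o g)^\+ w)%E \-
    (fun x => \int[P x]_w (EFin \o g)^\- w)%E)%E; last first.
  by apply/funext => x; rewrite integralE.
by apply: emeasurable_funB; apply: measurable_integral_kernel => //;
  [exact: measurable_funepos|exact: measurable_funeneg].
Qed.

Section integrable.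
Variable g : path -> R.
Hypothesis ig : (law_from mu P).-integrable setT (EFin \o g).

Let mg : measurable_fun setT (EFin \o g). Proof. exact: measurable_int ig. Qed.

Let i_integral (h : path -> \bar R) : (forall w, 0 <= h w)%E ->
  measurable_fun setT h -> (forall w, h w <= `|(g w)%:E|)%E ->
  mu.-integrable setT (fun x => \int[P x]_w h w)%E.
Proof.
move=> h0 mh hg; apply/integrableP; split; first exact: measurable_integral_kernel.
under eq_integral do rewrite gee0_abs ?integral_ge0//.
rewrite -ge0_integral_law_from//.
have /integrableP[_] := ig; apply: le_lt_trans.
by apply: ge0_le_integral => //; exact: measurableT_comp.
Qed.

Lemma Rintegral_law_from :
  \int[law_from mu P]_w g w = \int[mu]_x \int[P x]_w g w.
Proof.
have ip : mu.-integrable setT (fun x => \int[P x]_w (EFin \o g)^\+ w)%E.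
  apply: i_integral => //; first exact: measurable_funepos.
  move=> w; rewrite -[leRHS]/((abse \o (EFin \o g)) w) fune_abse.
  by rewrite leeDl.
have ine : mu.-integrable setT (fun x => \int[P x]_w (EFin \o g)^\- w)%E.
  apply: i_integral => //; first exact: measurable_funeneg.
  move=> w; rewrite -[leRHS]/((abse \o (EFin \o g)) w) fune_abse.
  by rewrite leeDr.
have E x : (\int[P x]_w (g w)%:E = \int[P x]_w (EFin \o g)^\+ w -
    \int[P x]_w (EFin \o g)^\- w)%E by rewrite integralE.
have ix : mu.-integrable setT (fun x => \int[P x]_w (g w)%:E)%E.
  apply: (eq_integrable measurableT _ _ _ (integrableB measurableT ip ine)).
  by move=> x _; rewrite E.
rewrite /Rintegral; congr fine; rewrite integral_fine//.
under [RHS]eq_integral do rewrite E.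
rewrite integralB// integralE !ge0_integral_law_from//.
- exact: measurable_funeneg.
- exact: measurable_funepos.
Qed.

End integrable.

End integration_from_initial_law.

(** * Stationarity of the two-point laws *)

Section two_point_law.
Context (R : realType) (T : pmetricType R).
Variables (P : R.-pker (borel T) ~> (cadlag_path T)) (mu : probability (borel T) R).
Hypotheses (FP : feller_process P) (IP : invariant_law mu P).
Local Notation path := (cadlag_path T).

Lemma invariant_law_eval (s : R) (A : set (borel T)) : 0 <= s -> measurable A ->
  law_from mu P (eval_at s @^-1` A) = mu (id @^-1` A).
Proof. by move=> s0 mA; exact: IP. Qed.

Let setA_eq (s : R) (A : set (borel T)) : 0 <= s -> measurable A ->
  measurable (eval_at s @^-1` A : set path).
Proof.
by move=> s0 mA; rewrite -[X in measurable X]setTI; exact: measurable_eval_at.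
Qed.

(** The right-hand side does not depend on s: the Markov property moves the
    second evaluation into the semigroup, after which only the state at time s is
    left and invariance applies. *)
Lemma markov_restricted (s u : R) (A : set (borel T)) (g : T -> R) :
  0 <= s -> 0 <= u -> measurable A -> bounded_continuous g ->
  \int[law_from mu P]_w (\1_A (w s) * g (w (s + u))) =
  \int[mu]_y (\1_A y * semigroup P u g y).
Proof.
move=> s0 u0 mA bg.
have bound (h : T -> R) : bounded_continuous h -> exists M, forall x, `|\1_A x * h x| <= M.
  case=> _ [M [_ hM]]; exists (M + 1) => x; rewrite normrM.
  rewrite (@le_trans _ _ (`|h x|))//; last by apply: hM => //; rewrite ltrDl.
  by rewrite ler_piMl// indicE ger0_norm// lern1; case: (_ \in _).
have [M gM] : exists M, forall x, `|g x| <= M.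
  by case: bg => _ [M [_ hM]]; exists (M + 1) => x; apply: hM => //; rewrite ltrDl.
have su0 : 0 <= s + u by exact: addr_ge0.
have mg (h : T -> R) : bounded_continuous h -> measurable_fun [set: borel T] h.
  by case=> ch _; exact: continuous_borel_measurable.
have bsg := feller_semigroup FP u0 bg.
have ind01 (x : T) : `|\1_A x : R| <= 1.
  by rewrite indicE ger0_norm// lern1; case: (_ \in _).
transitivity (\int[law_from mu P]_w (\1_A (w s) * semigroup P u g (w s))); last first.
  have := @Rintegral_same_law _ _ _ _ _ _ R (law_from mu P) mu
    (eval_at s) id (measurable_eval_at s0) (@measurable_id _ _ _)
    (fun A => @invariant_law_eval s A s0) (fun y => \1_A y * semigroup P u g y).
  by apply; apply: measurable_funM => //; exact: mg.
have m1 : measurable_fun [set: path] (fun w => \1_A (w s) * g (w (s + u))).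
  apply: measurable_funM.
    by apply: (measurableT_comp _ (measurable_eval_at s0)); exact: measurable_indic.
  by apply: (measurableT_comp _ (measurable_eval_at su0)); exact: mg.
have m2 : measurable_fun [set: path] (fun w => \1_A (w s) * semigroup P u g (w s)).
  apply: measurable_funM.
    by apply: (measurableT_comp _ (measurable_eval_at s0)); exact: measurable_indic.
  by apply: (measurableT_comp _ (measurable_eval_at s0)); exact: mg.
have [M2 sgM] := bound _ bsg.
have i2 : (law_from mu P).-integrable setT
    (EFin \o (fun w : path => \1_A (w s) * semigroup P u g (w s))).
  by apply: (@bounded_integrable _ _ _ _ _ _ M2 measurableT m2) => w; exact: sgM.
have i1 : (law_from mu P).-integrable setT
    (EFin \o (fun w : path => \1_A (w s) * g (w (s + u)))).
  apply: (@bounded_integrable _ _ _ _ _ _ M measurableT m1) => w.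
  by rewrite normrM (le_trans _ (gM (w (s + u))))// ler_piMl.
rewrite (Rintegral_law_from i1) (Rintegral_law_from i2).
apply: eq_Rintegral => x _.
have pat (h : path -> R) : \int[P x]_w (\1_A (w s) * h w) =
    \int[P x]_(w in [set w : path | A (w s)]) h w.
  rewrite [RHS]Rintegral_mkcond; apply: eq_Rintegral => w _.
  rewrite patchE indicE; case: (boolP (w s \in A)) => wA.
    by rewrite mem_set ?mul1r//; exact: set_mem wA.
  by rewrite memNset ?mul0r//; move: wA => /negP nA ?; apply: nA; exact/mem_set.
rewrite !pat; apply: (feller_markov FP) => //.
apply: sub_sigma_algebra; exists s; first by rewrite /= in_itv/= s0 lexx.
by exists A => //; rewrite setTI.
Qed.

Let rect (s u : R) (A B : set (borel T)) : set path :=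
  [set w | A (w s) /\ B (w (s + u))].

(* By markov_restricted the two sides are limits of the same sequence, g n
   being continuous approximations of the indicator of G. *)
Let rect_open (s u : R) (A G : set (borel T)) : 0 <= s -> 0 <= u ->
  measurable A -> @open T G ->
  law_from mu P (rect s u A G) = law_from mu P (rect 0 u A G).
Proof.
move=> s0 u0 mA oG.
have [g [bcg g01 gG]] := open_indic_approx oG.
have mG : measurable G by exact: sub_sigma_algebra.
have cv r : 0 <= r ->
    \int[law_from mu P]_w (\1_A (w r) * g n (w (r + u))) @[n --> \oo]
    --> fine (law_from mu P (rect r u A G)).
  move=> r0; have ru0 : 0 <= r + u by exact: addr_ge0.
  pose fn n (w : path) : \bar R := (\1_A (w r) * g n (w (r + u)))%:E.
  pose fl (w : path) : \bar R := (\1_A (w r) * \1_G (w (r + u)))%:E.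
  have mi (B : set (borel T)) q : 0 <= q -> measurable B ->
      measurable_fun [set: path] (fun w => \1_B (w q) : R).
    move=> q0 mB; apply: (measurableT_comp _ (measurable_eval_at q0)).
    exact: measurable_indic.
  have mfn n : measurable_fun setT (fn n).
    apply/measurable_EFinP/measurable_funM; first exact: mi.
    apply: (measurableT_comp _ (measurable_eval_at ru0)).
    by apply: continuous_borel_measurable; case: (bcg n).
  have mfl : measurable_fun setT fl.
    by apply/measurable_EFinP/measurable_funM; exact: mi.
  have [] := @dominated_convergence _ path R (law_from mu P) setT measurableT
    fn fl (cst 1%E) mfn mfl.
  - apply: aeW => w _; apply: cvg_EFin; first exact: nearW.
    by apply: cvgM; [exact: cvg_cst|exact: gG].
  - exact: finite_measure_integrable_cst.
  - apply: aeW => w n _; rewrite /fn /= lee_fin normrM.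
    have /andP[g0 g1] := g01 n (w (r + u)).
    rewrite (ger0_norm g0) indicE ger0_norm// mulr_ile1//.
    by rewrite lern1; case: (_ \in _).
  move=> _ _; rewrite (_ : (\int[law_from mu P]_w fl w)%E = law_from mu P (rect r u A G)).
    by move=> cvf; apply: fine_cvg; rewrite fineK// fin_num_measure//;
      apply: measurableI; exact: setA_eq.
  have mr : measurable (rect r u A G) by apply: measurableI; exact: setA_eq.
  transitivity (\int[law_from mu P]_w (\1_(rect r u A G) w)%:E)%E; last first.
    by rewrite integral_indic// setIT.
  apply: eq_integral => w _; congr EFin.
  have -> : rect r u A G = (eval_at r @^-1` A) `&` (eval_at (r + u) @^-1` G) by [].
  by rewrite indicI /= !indicE.
have cs := cv s s0; have c0 := cv 0 (lexx 0).
have E : (fun n => \int[law_from mu P]_w (\1_A (w s) * g n (w (s + u)))) =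
    (fun n => \int[law_from mu P]_w (\1_A (w 0) * g n (w (0 + u)))).
  by apply/funext => n; rewrite !markov_restricted.
have ls := cvg_lim (@Rhausdorff R) cs; have l0 := cvg_lim (@Rhausdorff R) c0.
have mr r : 0 <= r -> measurable (rect r u A G).
  by move=> r0; apply: measurableI; apply: setA_eq => //; exact: addr_ge0.
rewrite -(fineK (fin_num_measure _ _ (mr _ s0))).
rewrite -(fineK (fin_num_measure _ _ (mr _ (lexx 0)))).
by congr EFin; rewrite -ls E l0.
Qed.

(* For a fixed A both sides are finite measures in B that agree on the open
   sets, which are stable under intersection. *)
Let rect_borel (s u : R) (A B : set (borel T)) : 0 <= s -> 0 <= u ->
  measurable A -> measurable B ->
  law_from mu P (rect s u A B) = law_from mu P (rect 0 u A B).
Proof.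
move=> s0 u0 mA mB; have su0 : 0 <= s + u by exact: addr_ge0.
have u0' : 0 <= 0 + u by rewrite add0r.
have mAr r : 0 <= r -> measurable (eval_at r @^-1` A : set path) by move=> ?; exact: setA_eq.
have := @same_law_generated _ _ _ _ _ _ R
  (mrestr (law_from mu P) (mAr s s0)) (mrestr (law_from mu P) (mAr 0 (lexx 0)))
  (eval_at (s + u)) (eval_at (0 + u)) (measurable_eval_at su0)
  (measurable_eval_at u0') (@open T) erefl.
rewrite /mrestr => /(_ _ _ _ _ B mB).
have rectE r B' : rect r u A B' = (eval_at (r + u) @^-1` B') `&` (eval_at r @^-1` A).
  by rewrite setIC.
rewrite !rectE; apply.
- by move=> G1 G2; exact: openI.
- exact: openT.
- rewrite (le_lt_trans (probability_le1 _ _))// ?ltry//.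
  by apply: measurableI => //; exact: mAr.
- by move=> G oG; have := rect_open s0 u0 mA oG; rewrite !rectE.
Qed.

Let pair_at (s r : R) (w : path) : borel T * borel T := (w s, w r).

Let measurable_pair_at s r : 0 <= s -> 0 <= r ->
  measurable_fun setT (pair_at s r).
Proof. by move=> s0 r0; apply: measurable_fun_pair; exact: measurable_eval_at. Qed.

(** Rectangles generate the product sigma-algebra, so rect_borel extends to all
    measurable sets of pairs. *)
Lemma two_point_law_stationary (s u : R) (C : set (borel T * borel T)) :
  0 <= s -> 0 <= u -> measurable C ->
  law_from mu P [set w | C (w s, w (s + u))] =
  law_from mu P [set w | C (w 0, w u)].
Proof.
move=> s0 u0 mC.
apply: (same_law_generated (measurable_pair_at s0 (addr_ge0 s0 u0))
  (measurable_pair_at (lexx 0) u0) (measurable_prod_rectangles _ _)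
  (setI_closed_rectangles (T1 := borel T) (T2 := borel T))) => //.
- by exists setT => //; exists setT => //; rewrite setXTT.
- by rewrite (le_lt_trans (probability_le1 _ _))// ltry.
- move=> _ [A mA [B mB <-]]; have := rect_borel s0 u0 mA mB.
  by rewrite /rect add0r.
Qed.

End two_point_law.

(** * The stationary correlation function *)

Section correlation.
Context (R : realType) (T : pmetricType R).
Variables (P : R.-pker (borel T) ~> (cadlag_path T)) (mu : probability (borel T) R).
Hypotheses (FP : feller_process P) (IP : invariant_law mu P).
Local Notation path := (cadlag_path T).
Local Notation leb := (@lebesgue_measure R).
Local Notation law := (law_from mu P).
Variable f : borel T -> R.
Hypothesis mf : measurable_fun setT f.
Hypothesis if2 : mu.-integrable setT (fun x => (f x ^+ 2)%:E).

(** The observable along a path, extended to negative times by its value at 0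
    so as to be measurable on the whole product. *)
Definition observed (z : R * path) : R := f (z.2 (Num.max 0 z.1)).

Lemma measurable_observed : measurable_fun setT observed.
Proof. exact: (measurableT_comp mf (@measurable_eval R T)). Qed.

Lemma observedE s (w : path) : 0 <= s -> observed (s, w) = f (w s).
Proof. by move=> s0; rewrite /observed/= max_r. Qed.

Lemma measurable_observed_at s : measurable_fun setT (fun w => observed (s, w)).
Proof. exact: measurableT_comp measurable_observed (measurable_pair1 s). Qed.

Let mfw s : 0 <= s -> measurable_fun setT (fun w : path => f (w s)).
Proof. by move=> s0; exact: (measurableT_comp mf (measurable_eval_at s0)). Qed.

Lemma integral_sqr_eval s : 0 <= s ->
  (\int[law]_w (f (w s) ^+ 2)%:E = \int[mu]_x (f x ^+ 2)%:E)%E.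
Proof.
move=> s0.
apply: (@ge0_integral_same_law _ _ _ path (borel T) (borel T) R law mu
  (eval_at s) id (measurable_eval_at s0) (@measurable_id _ _ _)
  (fun A => @invariant_law_eval R T P mu IP s A s0) (fun y => (f y ^+ 2)%:E)).
  by move=> y; rewrite lee_fin sqr_ge0.
by apply/measurable_EFinP; exact: measurable_funX.
Qed.

Lemma integrable_sqr_eval s : 0 <= s ->
  law.-integrable setT (fun w => (f (w s) ^+ 2)%:E).
Proof.
move=> s0; apply/integrableP; split.
  by apply/measurable_EFinP; apply: measurable_funX; exact: mfw.
have /integrableP[_] := if2.
under eq_integral do rewrite gee0_abs ?lee_fin ?sqr_ge0//.
rewrite -(integral_sqr_eval s0) => fin.
by under eq_integral do rewrite gee0_abs ?lee_fin ?sqr_ge0//.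
Qed.

Lemma integrable_eval_mul s r : 0 <= s -> 0 <= r ->
  law.-integrable setT (fun w => (f (w s) * f (w r))%:E).
Proof.
move=> s0 r0; apply: integrable_prod_sqr => //; try exact: mfw;
  exact: integrable_sqr_eval.
Qed.

Lemma integrable_eval s : 0 <= s ->
  law.-integrable setT (fun w => (f (w s))%:E).
Proof.
move=> s0; have : law.-integrable setT (fun w => (f (w s) * 1)%:E).
  apply: (@integrable_prod_sqr _ path R law setT (fun w : path => f (w s)) (fun=> 1)) => //.
  - exact: mfw.
  - exact: integrable_sqr_eval.
  - by rewrite expr1n; exact: finite_measure_integrable_cst.
by congr integrable; apply/funext => w; rewrite mulr1.
Qed.

Let S : R := \int[mu]_x (f x ^+ 2).

Let integral_sqr_evalE s : 0 <= s -> (\int[law]_w (f (w s) ^+ 2)%:E = S%:E)%E.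
Proof.
move=> s0; rewrite integral_sqr_eval// fineK//.
exact: integrable_fin_num.
Qed.

Lemma integral_abs_eval_le s : 0 <= s ->
  (\int[law]_w `|f (w s)|%:E <= (1 + S)%:E)%E.
Proof.
move=> s0; rewrite EFinD -(integral_sqr_evalE s0).
have <- : (\int[law]_w (cst 1%E w) = 1)%E.
  by rewrite integral_cst// mul1e; exact: probability_setT.
rewrite -ge0_integralD//; last 2 first.
- by move=> w _; rewrite lee_fin sqr_ge0.
- by apply/measurable_EFinP; apply: measurable_funX; exact: mfw.
apply: ge0_le_integral => //.
- by apply/measurable_EFinP; apply: measurableT_comp => //; exact: mfw.
- apply: emeasurable_funD => //.
  by apply/measurable_EFinP; apply: measurable_funX; exact: mfw.
move=> w _; rewrite /= -EFinD lee_fin -real_normK ?num_real//.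
by have := sqr_ge0 (`|f (w s)| - 1); have := normr_ge0 (f (w s)); nra.
Qed.

Lemma integral_abs_eval_mul_le s r : 0 <= s -> 0 <= r ->
  (\int[law]_w `|f (w s) * f (w r)|%:E <= (S + S)%:E)%E.
Proof.
move=> s0 r0; rewrite EFinD -{1}(integral_sqr_evalE s0) -(integral_sqr_evalE r0).
have sqr_meas t : 0 <= t -> measurable_fun setT (fun w : path => (f (w t) ^+ 2)%:E).
  by move=> t0; apply/measurable_EFinP; apply: measurable_funX; exact: mfw.
rewrite -ge0_integralD//; try exact: sqr_meas;
  try by move=> w _; rewrite lee_fin sqr_ge0.
apply: ge0_le_integral => //.
- by apply/measurable_EFinP; apply: measurableT_comp => //; apply: measurable_funM; exact: mfw.
- by apply: emeasurable_funD; exact: sqr_meas.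
move=> w _; rewrite /= -EFinD lee_fin normrM.
rewrite -(real_normK (num_real (f (w s)))) -(real_normK (num_real (f (w r)))).
have := sqr_ge0 (`|f (w s)| - `|f (w r)|).
by have := normr_ge0 (f (w s)); have := normr_ge0 (f (w r)); nra.
Qed.

(** Extended to negative lags by symmetry, so that correlation (s - r) is the
    covariance of the values at times s and r in either order. *)
Definition correlation (u : R) : R :=
  \int[law]_w (f (w 0) * f (w `|u|)).

Lemma correlation_even u : correlation (- u) = correlation u.
Proof. by rewrite /correlation normrN. Qed.

Lemma measurable_correlation : measurable_fun setT correlation.
Proof.
pose k (z : path * R) := f (z.1 0) * observed (`|z.2|, z.1).
have mk : measurable_fun setT k.
  apply: measurable_funM.
    by apply: (measurableT_comp (mfw (lexx 0))); exact: measurable_fst.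
  apply: (measurableT_comp measurable_observed).
  apply: measurable_fun_pair; last exact: measurable_fst.
  by apply: measurableT_comp => //; exact: measurable_snd.
have := @measurable_Rintegral_param _ _ path R R law setT k measurableT mk.
congr measurable_fun; apply/funext => u; apply: eq_Rintegral => w _.
by rewrite /k/= observedE.
Qed.

Lemma correlation_two_point s r : 0 <= s -> 0 <= r ->
  \int[law]_w (f (w s) * f (w r)) = correlation (s - r).
Proof.
wlog rs : s r / s <= r => [hw|] s0 r0.
  have [/hw|/ltW/hw] := leP s r; first by apply.
  move=> /(_ r0 s0); rewrite -correlation_even opprB => <-.
  by apply: eq_Rintegral => w _; rewrite mulrC.
rewrite -correlation_even opprB /correlation ger0_norm ?subr_ge0//.
have d0 : 0 <= r - s by rewrite subr_ge0.
have E : r = s + (r - s) by rewrite addrC subrK.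
have mp a b : 0 <= a -> 0 <= b ->
    measurable_fun setT (fun w : path => (eval_at a w, eval_at b w)).
  by move=> a0 b0; apply: measurable_fun_pair; exact: measurable_eval_at.
have mF : measurable_fun [set: borel T * borel T] (fun z => f z.1 * f z.2).
  by apply: measurable_funM; apply: (measurableT_comp mf);
    [exact: measurable_fst|exact: measurable_snd].
have same C : measurable C ->
    law ((fun w => (eval_at s w, eval_at r w)) @^-1` C) =
    law ((fun w => (eval_at 0 w, eval_at (r - s) w)) @^-1` C).
  by move=> mC; rewrite {1}E; exact: two_point_law_stationary.
exact: (Rintegral_same_law (mp s r s0 r0) (mp 0 (r - s) (lexx 0) d0) same mF).
Qed.

Lemma ae_path_law_start (x : borel T) : {ae P x, forall w : path, w 0 = x}.
Proof.
have m1 : measurable ([set x] : set (borel T)).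
  rewrite -[X in measurable X]setCK; apply: measurableC; apply: sub_sigma_algebra.
  rewrite openC; apply: accessible_closed_set1; apply: hausdorff_accessible.
  exact: metric_hausdorff.
have mS : measurable ([set w | w 0 = x] : set path).
  by have := @measurable_eval_at R T 0 (lexx 0) measurableT _ m1; rewrite setTI.
exists (~` [set w : path | w 0 = x]); split => //; first exact: measurableC.
have := probability_setC (path_law P x) mS.
by rewrite /path_law (feller_start FP) subee.
Qed.

(** Under P x the factor f (w 0) is almost surely the constant f x. *)
Lemma Rintegral_law_from_start (h : path -> R) :
  law.-integrable setT (EFin \o h) ->
  law.-integrable setT (fun w => (f (w 0) * h w)%:E) ->
  \int[law]_w (f (w 0) * h w) = \int[mu]_x (f x * \int[P x]_w h w).
Proof.
move=> ih ifh.
have mh : measurable_fun setT h by apply/measurable_EFinP; exact: measurable_int ih.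
have mfh : measurable_fun setT (fun w : path => f (w 0) * h w).
  by apply/measurable_EFinP; exact: measurable_int ifh.
rewrite (Rintegral_law_from ifh); apply: eq_Rintegral => x _.
rewrite -RintegralZl_measurable//; apply: ae_eq_Rintegral => //.
  exact: measurable_funM.
by apply: filterS (ae_path_law_start x) => w ->.
Qed.

Lemma correlation_inner t : 0 <= t -> correlation t = inner mu f (semigroup P t f).
Proof.
move=> t0; rewrite /correlation ger0_norm//.
by rewrite (Rintegral_law_from_start (integrable_eval t0))//; exact: integrable_eval_mul.
Qed.

End correlation.

(** * Reflections, even kernels and power tails on the line *)

Section lebesgue_reflection.
Context (R : realType).
Local Notation leb := (@lebesgue_measure R).

Lemma measurable_reflect (c : R) : measurable_fun setT (fun x : R => c - x).
Proof. exact: measurable_funB. Qed.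

(** Checked on half-open intervals, which determine Lebesgue measure.
    Translations are compositions of two reflections. *)
Lemma lebesgue_measure_reflect (c : R) (A : set (measurableTypeR R)) :
  measurable A -> leb ((fun x => c - x) @^-1` A) = leb (id @^-1` A).
Proof.
move=> mA; rewrite preimage_id.
pose p : {mfun measurableTypeR R >-> measurableTypeR R} :=
  HB.pack (fun x : R => c - x) 
    (isMeasurableFun.Build _ _ (measurableTypeR R) (measurableTypeR R) _ (measurable_reflect c)).
apply/esym; apply: (@lebesgue_measure_unique R (pushforward leb p)) mA.
move=> _ [[a b] _ <-] /=; rewrite /pushforward /=.
have -> : (fun x => c - x) @^-1` `]a, b] = `[c - b, c - a[%classic :> set R.
  apply/seteqP; split => x /=; rewrite !in_itv/= => /andP[h1 h2];
    by apply/andP; split; lra.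
rewrite !lebesgue_measure_itv/= !lte_fin ltrD2l ltrN2.
by case: ifP => // _; rewrite -!EFinB; congr EFin; ring.
Qed.

Lemma Rintegral_reflect (a b c : R) (g : R -> R) : measurable_fun setT g ->
  \int[leb]_(x in `[a, b]) g (c - x) = \int[leb]_(x in `[c - b, c - a]) g x.
Proof.
move=> mg; rewrite Rintegral_mkcond [RHS]Rintegral_mkcond.
have mgp : measurable_fun setT (g \_ `[c - b, c - a]).
  by apply/(measurable_restrictT g (measurable_itv _)); exact: measurable_funTS.
have := @Rintegral_same_law _ _ _ (measurableTypeR R) (measurableTypeR R)
  (measurableTypeR R) R leb leb (fun x => c - x) id (measurable_reflect c)
  (@measurable_id _ _ _) (lebesgue_measure_reflect c) _ mgp.
move=> <-.
apply: eq_Rintegral => x _; rewrite !patchE.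
suff -> : (x \in `[a, b]%classic) = (c - x \in `[c - b, c - a]%classic) by [].
by rewrite !mem_setE !in_itv/= !lerD2l !lerN2 andbC.
Qed.

End lebesgue_reflection.

Section symmetric_kernel.
Context (R : realType).
Local Notation leb := (@lebesgue_measure R).
Variable rho : R -> R.
Hypothesis mrho : measurable_fun setT rho.
Hypothesis rho_even : forall u, rho (- u) = rho u.
Variable M : R.
Hypothesis rho_bounded : forall u, `|rho u| <= M.

Definition primitive (x : R) : R := \int[leb]_(u in `[0, x]) rho u.

Let irho_seg a b : leb.-integrable `[a, b] (EFin \o rho).
Proof.
apply: measurable_bounded_integrable => //.
- rewrite /= lebesgue_measure_itv/=; case: ifP => _; last exact: ltry.
  by rewrite -EFinB ltry.
- exact: measurable_funTS.
- exists M; split; first exact: num_real.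
  by move=> r Mr x _; exact: le_trans (rho_bounded x) (ltW Mr).
Qed.

Lemma integrable_primitive (tau : R) :
  leb.-integrable `[0, tau] (EFin \o primitive).
Proof.
have [tau0|tau0] := ltP tau 0.
  by rewrite set_itv_ge ?bnd_simp -?ltNge//; exact: integrable_set0.
apply: continuous_compact_integrable; first exact: segment_compact.
exact: parameterized_integral_continuous.
Qed.

Let integrable_reflect (a b c : R) (g : R -> R) : measurable_fun setT g ->
  leb.-integrable `[c - b, c - a] (EFin \o g) ->
  leb.-integrable `[a, b] (EFin \o (fun x => g (c - x))).
Proof.
move=> mg ig0; have ig := (@integrable_mkcond _ _ _ leb _ _ (measurable_itv _)).1 ig0.
apply: (@integrable_mkcond _ _ _ leb _ _ (measurable_itv _)).2.
have mgp : measurable_fun setT ((EFin \o g) \_ `[c - b, c - a]).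
  exact: measurable_int ig.
have := @integrable_same_law _ _ _ (measurableTypeR R) (measurableTypeR R)
  (measurableTypeR R) R leb leb (fun x => c - x) id (measurable_reflect c)
  (@measurable_id _ _ _) (@lebesgue_measure_reflect R c) _ mgp ig.
congr integrable; apply/funext => x /=; rewrite !patchE.
suff -> : (x \in `[a, b]%classic) = (c - x \in `[c - b, c - a]%classic) by [].
by rewrite !mem_setE !in_itv/= !lerD2l !lerN2 andbC.
Qed.

(** Split at r = s: on [0, s] reflect in s; on [s, tau] do the same, and
    then use evenness to come back to positive arguments. *)
Lemma integral_even_kernel (tau s : R) : 0 <= s -> s <= tau ->
  \int[leb]_(r in `[0, tau]) rho (s - r) = primitive s + primitive (tau - s).
Proof.
move=> s0 stau.
have i a b : leb.-integrable `[a, b] (EFin \o (fun r => rho (s - r))).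
  exact: integrable_reflect.
have := Rintegral_itvB (i 0 tau) (_ : (BLeft 0 <= BRight s)%O)
  (_ : (BRight s <= BRight tau)%O).
rewrite !bnd_simp => /(_ s0 stau).
rewrite Rintegral_itv_obnd_cbnd; last first.
  apply: integrableS (i s tau) => //; exact: subset_itv_oc_cc.
rewrite !Rintegral_reflect// subrr subr0 => /eqP.
rewrite subr_eq => /eqP ->; rewrite [LHS]addrC; congr (_ + _).
transitivity (\int[leb]_(u in `[s - tau, 0]) rho (0 - u)).
  by apply: eq_Rintegral => u _; rewrite sub0r rho_even.
by rewrite Rintegral_reflect// subr0 sub0r opprB.
Qed.

(** Summing integral_even_kernel over s, the two terms have the same integral
    by reflection of [0, tau]. *)
Lemma double_integral_even_kernel (tau : R) : 0 <= tau ->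
  \int[leb]_(s in `[0, tau]) \int[leb]_(r in `[0, tau]) rho (s - r) =
  2 * \int[leb]_(s in `[0, tau]) primitive s.
Proof.
move=> tau0.
have -> : \int[leb]_(s in `[0, tau]) \int[leb]_(r in `[0, tau]) rho (s - r) =
    \int[leb]_(s in `[0, tau]) (primitive s + primitive (tau - s)).
  apply: eq_Rintegral => s; rewrite mem_setE in_itv/= => /andP[s0 stau].
  exact: integral_even_kernel.
pose h := primitive \_ `[0, tau].
have ih : leb.-integrable setT (EFin \o h).
  rewrite -restrict_EFin; apply: (@integrable_mkcond _ _ _ leb _ _ (measurable_itv _)).1.
  exact: integrable_primitive.
have mh : measurable_fun setT h by apply/measurable_EFinP; exact: measurable_int ih.
have ih' : leb.-integrable `[0, tau] (EFin \o h) by exact: integrableS ih.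
have hE : \int[leb]_(s in `[0, tau]) (primitive s + primitive (tau - s)) =
    \int[leb]_(s in `[0, tau]) (h s + h (tau - s)).
  apply: eq_Rintegral => s; rewrite mem_setE in_itv/= => /andP[s0 stau].
  by rewrite /h !patchE !mem_setE !in_itv/= s0 stau subr_ge0 stau lerBlDr lerDl s0.
rewrite hE RintegralD//; last first.
  by apply: integrable_reflect => //; rewrite subrr subr0.
rewrite Rintegral_reflect// subrr subr0 mulr2n mulrDl mul1r.
by congr (_ + _); apply: eq_Rintegral => s sin; rewrite /h patchE sin.
Qed.

End symmetric_kernel.

Section tails.
Context (R : realType).
Local Notation leb := (@lebesgue_measure R).

Lemma integral_power_tail (alpha r : R) : 1 < alpha -> 0 <= r ->
  (\int[leb]_(u in `[r, +oo[) ((1 + u) `^ (- alpha))%:E =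
   ((alpha - 1)^-1 * (1 + r) `^ (- (alpha - 1)))%:E)%E.
Proof.
move=> a1 r0.
have b0 : 0 < alpha - 1 by rewrite subr_gt0.
pose F (u : R) : R := - ((alpha - 1)^-1 * (1 + u) `^ (- (alpha - 1))).
have dF (u : R) : r <= u -> is_derive u 1 F ((1 + u) `^ (- alpha)).
  move=> ru; have u1 : 0 < 1 + u by rewrite ltr_pwDl// (le_trans r0).
  have d1 : is_derive u 1 (fun v : R => 1 + v) 1.
    by have := is_deriveD (is_derive_cst (1 : R) u 1) (is_derive_id u 1); rewrite add0r.
  have d2 : is_derive (1 + u) 1 (fun v : R => v `^ (- (alpha - 1)))
      (- (alpha - 1) * (1 + u) `^ (- (alpha - 1) - 1)).
    exact: is_derive1_powR.
  have := is_derive1_comp d2 d1; rewrite -[_ \o _]/(fun v => (1 + v) `^ (- (alpha - 1))) => d3.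
  have d4 := is_deriveN (is_deriveZ (alpha - 1)^-1 d3).
  have {d4} : is_derive u 1 F _ := d4.
  move=> d4; apply: is_derive_eq d4 _.
  rewrite /GRing.scale/= mulr1 mulrA mulrN mulVf ?gt_eqF// mulN1r opprK.
  by congr (_ `^ _); ring.
have cF u : r <= u -> {for u, continuous F}.
  move=> ru; apply: differentiable_continuous; apply/derivable1_diffP.
  by have := dF u ru => -[].
rewrite (@ge0_continuous_FTC2y R _ F r 0).
- by rewrite sub0e -EFinN opprK.
- by move=> x _; exact: powR_ge0.
- apply: derivable_within_continuous => u; rewrite in_itv/= andbT => ru.
  have u1 : 0 < 1 + u by rewrite ltr_pwDl// (le_trans r0).
  have d1 : is_derive u 1 (fun v : R => 1 + v) 1.
    by have := is_deriveD (is_derive_cst (1 : R) u 1) (is_derive_id u 1); rewrite add0r.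
  by have [] := is_derive1_comp (is_derive1_powR (- alpha) u1) d1.
- rewrite -oppr0; apply: cvgN; rewrite -(mulr0 (alpha - 1)^-1).
  apply: cvgM; first exact: cvg_cst.
  apply/cvgrPdist_le => e e0; near=> u.
  (* (1 + u) `^ (- (alpha - 1)) <= e as soon as u is beyond this power of e *)
  have u0 : e `^ (- (alpha - 1)^-1) <= u by near: u; apply: nbhs_pinfty_ge; rewrite num_real.
  have u0' : 0 <= u by apply: le_trans u0; exact: powR_ge0.
  rewrite sub0r normrN ger0_norm ?powR_ge0//.
  rewrite powRN -[leRHS]invrK lef_pV2 ?posrE ?powR_gt0 ?invr_gt0 ?ltr_pwDl//.
  apply: (@le_trans _ _ ((e `^ (- (alpha - 1)^-1)) `^ (alpha - 1))).
    by rewrite -powRrM mulNr mulVf ?gt_eqF// powR_inv1// ltW.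
  have u1 : 0 <= 1 + u by rewrite addr_ge0.
  apply: ge0_ler_powR; rewrite ?nnegrE ?powR_ge0// ?(ltW b0)//.
  by apply: le_trans u0 _; rewrite lerDr.
- by move=> u ru; have [] := dF u (ltW ru).
- by apply: cvg_at_right_filter; exact: cF.
- move=> u; rewrite in_itv/= andbT => ru.
  by rewrite derive1E; have [_ ->] := dF u (ltW ru).
Unshelve. all: by end_near. Qed.

Lemma integral_expR_lty (lambda : R) : 0 < lambda ->
  (\int[leb]_(u in `[0%R, +oo[) (expR (- (lambda * u)))%:E < +oo)%E.
Proof.
move=> l0.
have ip := integrable_exponential_pdf l0.
have {}ip : leb.-integrable `[0, +oo[ (EFin \o exponential_pdf lambda).
  exact: integrableS ip.
have i2 := @integrableZl _ _ _ leb _ (measurable_itv _) lambda^-1 _ ip.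
have := @integrable_lty _ _ _ leb _ (measurable_itv _) _ i2.
congr (_ < _)%E; apply: eq_integral => u; rewrite mem_setE in_itv/= andbT => u0.
by rewrite exponential_pdfE// -EFinM mulrA mulVf ?gt_eqF// mul1r mulNr.
Qed.

End tails.

(** * The resolvent as the Laplace transform of the correlation *)

Section time_space_kernel.
Context (R : realType) (T : pmetricType R).
Variable P : R.-pker (borel T) ~> (cadlag_path T).
Local Notation path := (cadlag_path T).

(** P with an idle time parameter, so that the measurability of integrals
    against a kernel applies to integrands depending on time. *)
Definition space_kernel (z : R * borel T) : {measure set path -> \bar R} := P z.2.

Let measurable_space_kernel U : measurable U ->
  measurable_fun setT (space_kernel ^~ U).
Proof.
by move=> mU; exact: (measurableT_comp (measurable_kernel P U mU) measurable_snd).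
Qed.

HB.instance Definition _ := isKernel.Build _ _ _ _ R space_kernel
  measurable_space_kernel.

HB.instance Definition _ := Kernel_isProbability.Build _ _ _ _ R space_kernel
  (fun z => prob_kernel z.2).

Lemma measurable_Rintegral_time_space (k : R * path -> R) :
  measurable_fun setT k ->
  measurable_fun setT (fun z : R * borel T => \int[P z.2]_w k (z.1, w)).
Proof.
move=> mk; apply: measurable_fine.
pose K : (R * borel T) * path -> \bar R := fun y => (k (y.1.1, y.2))%:E.
have mK : measurable_fun setT K.
  apply/measurable_EFinP; apply: (measurableT_comp mk).
  apply: measurable_fun_pair; last exact: measurable_snd.
  exact: (measurableT_comp measurable_fst measurable_fst).
rewrite (_ : (fun _ => _) = (fun z => \int[space_kernel z]_w K^\+ (z, w))%E \-
    (fun z => \int[space_kernel z]_w K^\- (z, w))%E)%E; last first.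
  apply/funext => z; rewrite integralE; congr (_ - _)%E; apply: eq_integral => w _.
  by rewrite !funeposE. by rewrite !funenegE.
apply: emeasurable_funB; apply: measurable_fun_integral_finite_kernel => //.
- exact: measurable_funepos.
- exact: measurable_funeneg.
Qed.

End time_space_kernel.

Section resolvent.
Context (R : realType) (T : pmetricType R).
Variables (P : R.-pker (borel T) ~> (cadlag_path T)) (mu : probability (borel T) R).
Hypotheses (FP : feller_process P) (IP : invariant_law mu P).
Local Notation path := (cadlag_path T).
Local Notation leb := (@lebesgue_measure R).
Local Notation law := (law_from mu P).
Variable f : borel T -> R.
Hypothesis mf : measurable_fun setT f.
Hypothesis if2 : mu.-integrable setT (fun x => (f x ^+ 2)%:E).
Variable lambda : R.
Hypothesis lambda_gt0 : 0 < lambda.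

Local Notation D := (`[0, +oo[%classic : set R).

Let discount (t : R) : R := expR (- (lambda * t)).

Let measurable_discount : measurable_fun setT discount.
Proof.
apply: (measurableT_comp (@measurable_expR R)).
by apply: measurable_funN; exact: measurable_funM.
Qed.

Let integrable_discounted (g : R * path -> R) (B : R) : measurable_fun setT g ->
  (forall t, 0 <= t -> (\int[law]_w `|g (t, w)|%:E <= B%:E)%E) ->
  (leb \x law)%E.-integrable (D `*` setT) (EFin \o (fun z => discount z.1 * g z)).
Proof.
move=> mg gB.
have mdg : measurable_fun setT (fun z : R * path => discount z.1 * g z).
  apply: measurable_funM => //.
  by apply: (measurableT_comp measurable_discount); exact: measurable_fst.
apply: (@integrable_prodX_dominated _ _ _ _ _ leb law _ _ _ mdg
  (fun t => B * discount t)) => //.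
  have id : leb.-integrable D (EFin \o discount).
    apply/integrableP; split.
      by apply/measurable_EFinP; exact: measurable_funTS.
    under eq_integral do rewrite gee0_abs ?lee_fin ?expR_ge0//.
    exact: integral_expR_lty.
  have -> : EFin \o (fun t => B * discount t) = (fun t => B%:E * (EFin \o discount) t)%E.
    by apply/funext => t; rewrite /= EFinM.
  exact: integrableZl.
move=> t; rewrite /= in_itv/= andbT => t0.
under eq_integral do rewrite normrM (ger0_norm (expR_ge0 _)) EFinM.
rewrite ge0_integralZl//; last first.
  apply/measurable_EFinP; apply: measurableT_comp => //.
  exact: measurableT_comp mg (measurable_pair1 t).
by rewrite EFinM muleC lee_wpmul2r ?lee_fin ?expR_ge0// gB.
Qed.

Let obs := observed f.

Let mobs : measurable_fun setT obs. Proof. exact: measurable_observed. Qed.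

Let mobs_at t : measurable_fun setT (fun w : path => obs (t, w)).
Proof. exact: measurable_observed_at. Qed.

Let mstart : measurable_fun setT (fun w : path => f (w 0)).
Proof. exact: (measurableT_comp mf (measurable_eval_at (lexx 0))). Qed.

Let k1 (z : R * path) := discount z.1 * obs z.

Let k2 (z : R * path) := discount z.1 * (f (z.2 0) * obs z).

Let mk1 : measurable_fun setT k1.
Proof.
apply: measurable_funM => //.
by apply: (measurableT_comp measurable_discount); exact: measurable_fst.
Qed.

Let mk2 : measurable_fun setT k2.
Proof.
apply: measurable_funM; last apply: measurable_funM => //.
- by apply: (measurableT_comp measurable_discount); exact: measurable_fst.
- by apply: (measurableT_comp mstart); exact: measurable_snd.
Qed.

Let ik1 : (leb \x law)%E.-integrable (D `*` setT) (EFin \o k1).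
Proof.
apply: (integrable_discounted mobs) => t t0.
under eq_integral do rewrite /obs observedE//.
exact: integral_abs_eval_le.
Qed.

Let ik2 : (leb \x law)%E.-integrable (D `*` setT) (EFin \o k2).
Proof.
apply: (@integrable_discounted (fun z => f (z.2 0) * obs z)).
  apply: measurable_funM => //.
  by apply: (measurableT_comp mstart); exact: measurable_snd.
move=> t t0; under eq_integral do rewrite /obs observedE//.
by apply: integral_abs_eval_mul_le.
Qed.

(* The discounted time integral of a single path; the resolvent at x is its
   mean under P x. *)
Let J (w : path) : R := \int[leb]_(t in D) k1 (t, w).

Let iJ : law.-integrable setT (EFin \o J).
Proof. by apply: (integrable_Rintegral2 _ _ ik1). Qed.

Let fJE (w : path) : f (w 0) * J w = \int[leb]_(t in D) k2 (t, w).
Proof.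
rewrite -RintegralZl_measurable//; last first.
  by apply: measurable_funTS; exact: measurableT_comp mk1 (measurable_pair2 w).
by apply: eq_Rintegral => t _; rewrite /k1 /k2 mulrCA.
Qed.

Let ifJ : law.-integrable setT (fun w => (f (w 0) * J w)%:E).
Proof.
have := integrable_Rintegral2 _ _ ik2.
move=> /(_ (measurable_itv _) mk2); congr is_true; congr integrable.
by apply/funext => w; rewrite fJE.
Qed.

Let resolventE x : resolvent P lambda f x = \int[leb]_(t in D) \int[P x]_w k1 (t, w).
Proof.
apply: eq_Rintegral => t; rewrite mem_setE in_itv/= andbT => t0.
rewrite /k1 /= RintegralZl_measurable//; congr (_ * _).
by apply: eq_Rintegral => w _; rewrite /obs observedE.
Qed.

(* Fubini under P x holds for almost every starting point only: integrability
   is known under the law started from mu. *)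
Let ae_resolvent : {ae mu, forall x, resolvent P lambda f x = \int[P x]_w J w}.
Proof.
have mH := measurable_integral_abs_param leb (measurable_itv `[0%R, +oo[) mk1.
have finH := (integrable_prodX_swapP leb law (measurable_itv `[0%R, +oo[) mk1).1 ik1.
have H0 (w : path) : (0 <= \int[leb]_(t in `[0%R, +oo[) `|k1 (t, w)|%:E)%E.
  by apply: integral_ge0 => t _; rewrite lee_fin.
have := ae_lty_path_law H0 mH finH.
apply: filterS => x fx; rewrite resolventE.
have ix := (integrable_prodX_swapP leb (path_law P x) (measurable_itv `[0%R, +oo[) mk1).2 fx.
by rewrite [LHS](Rintegral_fubini _ _ ix).
Qed.

Lemma measurable_resolvent : measurable_fun setT (resolvent P lambda f).
Proof.
rewrite (_ : resolvent P lambda f = fun x => \int[leb]_(t in D) \int[P x]_w k1 (t, w)).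
  have mk := measurable_Rintegral_time_space P mk1.
  exact: (measurable_Rintegral_param leb (measurable_itv `[0%R, +oo[) mk).
by apply/funext => x; rewrite resolventE.
Qed.

(** Both sides are the mean of f (w 0) * J w: seen from the starting point x it
    is the left-hand side, and exchanging time and paths the right-hand side. *)
Lemma inner_resolvent : inner mu f (resolvent P lambda f) =
  \int[leb]_(t in `[0, +oo[) (expR (- (lambda * t)) * correlation P mu f t).
Proof.
have mJ : measurable_fun setT J by apply/measurable_EFinP; exact: measurable_int iJ.
have -> : inner mu f (resolvent P lambda f) = \int[mu]_x (f x * \int[P x]_w J w).
  apply: ae_eq_Rintegral.
  - by apply: measurable_funM => //; exact: measurable_resolvent.
  - by apply: measurable_funM => //; exact: measurable_Rintegral_kernel.
  - by apply: filterS ae_resolvent => x ->.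
rewrite -(Rintegral_law_from_start FP iJ ifJ).
under eq_Rintegral do rewrite fJE.
rewrite -(Rintegral_fubini _ _ ik2)//.
apply: eq_Rintegral => t; rewrite mem_setE in_itv/= andbT => t0.
rewrite /k2 /= RintegralZl_measurable//; last exact: measurable_funM.
congr (_ * _); rewrite /correlation ger0_norm//.
by apply: eq_Rintegral => w _; rewrite /obs observedE.
Qed.

End resolvent.

(** * The asymptotic variance and the bias after extrapolation *)

Section asymptotic_variance.
Context (R : realType) (T : pmetricType R).
Variables (P : R.-pker (borel T) ~> (cadlag_path T)) (mu : probability (borel T) R).
Hypotheses (FP : feller_process P) (IP : invariant_law mu P).
Local Notation leb := (@lebesgue_measure R).
Variable f : borel T -> R.
Hypothesis mf : measurable_fun setT f.
Hypothesis if2 : mu.-integrable setT (fun x => (f x ^+ 2)%:E).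
Variable alpha : R.
Hypothesis alpha_gt1 : 1 < alpha.
Hypothesis decay : forall t : R, 0 <= t ->
  `|inner mu f (semigroup P t f)| <= (1 + t) `^ (- alpha).

Local Notation D := (`[0%R, +oo[%classic : set R).
Local Notation rho := (correlation P mu f).
Local Notation Phi := (\int[leb]_(u in `[0, +oo[) rho u).

Lemma correlation_decay u : `|rho u| <= (1 + `|u|) `^ (- alpha).
Proof.
have -> : rho u = rho `|u| by rewrite /correlation normr_id.
by rewrite correlation_inner//; exact: decay.
Qed.

Lemma correlation_le1 u : `|rho u| <= 1.
Proof.
apply: le_trans (correlation_decay u) _.
rewrite -[leRHS](powRr0 (1 + `|u|)); apply: ler_powR; first by rewrite lerDl.
by rewrite oppr_le0 ltW// (lt_trans ltr01).
Qed.

Let measurable_power :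
  measurable_fun setT (fun u : R => (1 + u) `^ (- alpha)).
Proof.
apply: (measurableT_comp (measurable_powR _)).
exact: measurable_funD.
Qed.

Let integrable_power (r : R) : 0 <= r ->
  leb.-integrable `[r, +oo[ (EFin \o (fun u : R => (1 + u) `^ (- alpha))).
Proof.
move=> r0; apply/integrableP; split.
  by apply/measurable_EFinP; exact: measurable_funTS.
under eq_integral do rewrite gee0_abs ?lee_fin ?powR_ge0//.
by rewrite integral_power_tail// ltry.
Qed.

Lemma integrable_correlation : leb.-integrable `[0, +oo[ (EFin \o rho).
Proof.
apply: (le_integrable _ _ _ (integrable_power (lexx 0))) => //.
  apply/measurable_EFinP; apply: measurable_funTS; exact: measurable_correlation.
move=> u; rewrite /= in_itv/= andbT => u0; rewrite lee_fin (ger0_norm (powR_ge0 _ _)).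
by have := correlation_decay u; rewrite (ger0_norm u0).
Qed.

(** Dominated convergence as the discount rate tends to 0, the correlation
    itself being the integrable bound. *)
Lemma sigma2_correlation : sigma2 mu P f = 2 * Phi.
Proof.
rewrite /sigma2; congr (_ * _); apply: cvg_lim; first exact: Rhausdorff.
apply/cvg_at_rightP => l [l0 lcv].
have E n : inner mu f (resolvent P (l n) f) =
    fine (\int[leb]_(t in `[0%R, +oo[) (expR (- (l n * t)) * rho t)%:E)%E.
  exact: inner_resolvent.
have -> : (fun n => inner mu f (resolvent P (l n) f)) =
  (fun n => fine (\int[leb]_(t in `[0%R, +oo[) (expR (- (l n * t)) * rho t)%:E)%E).
  by apply/funext.
have mg n : measurable_fun D (fun t : R => (expR (- (l n * t)) * rho t)%:E).
  apply: measurable_funTS; apply/measurable_EFinP; apply: measurable_funM.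
    apply: (measurableT_comp (@measurable_expR R)).
    by apply: measurable_funN; exact: measurable_funM.
  exact: measurable_correlation.
have mr : measurable_fun D (fun t : R => (rho t)%:E).
  apply: measurable_funTS; apply/measurable_EFinP; exact: measurable_correlation.
have [] := @dominated_convergence _ _ R leb D (measurable_itv _)
  (fun n t => (expR (- (l n * t)) * rho t)%:E) (fun t => (rho t)%:E)
  (fun t => `|rho t|%:E) mg mr.
- apply: aeW => t _; apply: cvg_EFin; first exact: nearW.
  rewrite -[X in _ --> X]mul1r; apply: cvgM; last exact: cvg_cst.
  rewrite -[X in _ --> X](@expR0 R); apply: continuous_cvg; first exact: continuous_expR.
  rewrite -oppr0; apply: cvgN; rewrite -(mul0r t).
  by apply: cvgM => //; exact: cvg_cst.
- exact: (integrable_abse integrable_correlation).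
- apply: aeW => t n; rewrite /= in_itv/= andbT => t0.
  rewrite lee_fin normrM ler_piMl// (ger0_norm (expR_ge0 _)).
  by rewrite -[leRHS]expR0 ler_expR oppr_le0 mulr_ge0// ltW.
move=> _ _ cv; apply: fine_cvg; rewrite fineK//.
by apply: (integrable_fin_num _ integrable_correlation).
Qed.

Lemma primitive_correlation_tail r : 0 <= r ->
  `|primitive rho r - Phi| <= (alpha - 1)^-1 * (1 + r) `^ (- (alpha - 1)).
Proof.
move=> r0; rewrite distrC.
have sub : (`]r, +oo[%classic : set R) `<=` D.
  move=> u; rewrite /= !in_itv/= !andbT => ru; exact: le_trans r0 (ltW ru).
have sub' : (`[r, +oo[%classic : set R) `<=` D.
  move=> u; rewrite /= !in_itv/= !andbT; exact: le_trans.
rewrite Rintegral_itvB ?bnd_simp//; last exact: integrable_correlation.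
have ir : leb.-integrable `[r, +oo[ (EFin \o rho).
  by apply: integrableS integrable_correlation.
rewrite Rintegral_itv_obnd_cbnd; last first.
  by apply: integrableS integrable_correlation.
apply: le_trans (le_normr_Rintegral _ ir) _ => //.
have -> : (alpha - 1)^-1 * (1 + r) `^ (- (alpha - 1)) =
    \int[leb]_(u in `[r, +oo[) ((1 + u) `^ (- alpha)).
  by rewrite /Rintegral integral_power_tail.
apply: le_Rintegral => //.
- exact: (integrable_abse ir).
- exact: integrable_power.
- move=> u; rewrite /= in_itv/= andbT => ru.
  by have := correlation_decay u; rewrite (ger0_norm (le_trans r0 ru)).
Qed.

(** The difference of the two integrals is the integral over ]t, 2 t] only,
    where the primitive is within primitive_correlation_tail of its limit;
    the times s < t, at which it may be far from it, have cancelled. *)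
Lemma average_primitive_bias (t : R) : 0 < t ->
  `|2 / t * (\int[leb]_(s in `[0, 2 * t]) primitive rho s -
             \int[leb]_(s in `[0, t]) primitive rho s) - 2 * Phi|
  <= 2 / (alpha - 1) * t `^ (- (alpha - 1)).
Proof.
move=> t0.
have ip a : leb.-integrable `[0, a] (EFin \o primitive rho).
  apply: (integrable_primitive _ correlation_le1).
  exact: measurable_correlation.
have tt : t <= 2 * t by lra.
rewrite Rintegral_itvB ?bnd_simp//; last exact: ltW.
have io : leb.-integrable `]t, 2 * t] (EFin \o primitive rho).
  apply: integrableS (ip (2 * t)) => // u; rewrite /= !in_itv/= => /andP[tu ->].
  by rewrite (le_trans (ltW t0) (ltW tu)).
have fin : (leb (`]t, (2 * t)%R]%classic : set R) = t%:E)%E.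
  rewrite lebesgue_measure_itv/= lte_fin ltr_pMl// ltr1n -EFinB; congr EFin; ring.
have ic c : leb.-integrable `]t, 2 * t] (EFin \o cst c).
  by apply: measurable_bounded_integrable => //; [rewrite /= fin ltry|exact: bounded_cst].
have -> : 2 * Phi = 2 / t * \int[leb]_(s in `]t, 2 * t]) Phi.
  rewrite Rintegral_cst// [X in fine X]fin /=; field; exact: lt0r_neq0.
rewrite -mulrBr -RintegralB//; last exact: ic.
rewrite normrM (ger0_norm (_ : 0 <= 2 / t)); last by rewrite divr_ge0// ltW.
have idiff : leb.-integrable `]t, 2 * t] (EFin \o (fun s => primitive rho s - Phi)).
  have -> : EFin \o (fun s => primitive rho s - Phi) =
      ((EFin \o primitive rho) \- (EFin \o cst Phi))%E by apply/funext => s /=.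
  by apply: integrableB => //; exact: ic.
pose B := (alpha - 1)^-1 * t `^ (- (alpha - 1)).
have b0 : 0 < alpha - 1 by rewrite subr_gt0.
have le : \int[leb]_(s in `]t, 2 * t]) `|primitive rho s - Phi| <=
    \int[leb]_(s in `]t, 2 * t]) B.
  apply: le_Rintegral => //; [exact: (integrable_abse idiff)|exact: ic|].
  move=> s; rewrite /= in_itv/= => /andP[ts _].
  have s0 : 0 <= s by rewrite (le_trans (ltW t0))// ltW.
  apply: le_trans (primitive_correlation_tail s0) _.
  rewrite ler_wpM2l ?invr_ge0 ?(ltW b0)// !powRN lef_pV2 ?posrE ?powR_gt0//; last by lra.
  by apply: ge0_ler_powR; rewrite ?nnegrE ?(ltW b0)//; lra.
have := le_trans (@le_normr_Rintegral _ _ _ leb _ _ (measurable_itv _) idiff) le.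
rewrite Rintegral_cst// [X in fine X]fin /= => le2.
apply: le_trans (ler_wpM2l _ le2) _; first by rewrite divr_ge0// ltW.
by rewrite /B le_eqVlt; apply/orP; left; apply/eqP; field; rewrite !lt0r_neq0.
Qed.

End asymptotic_variance.

(** * The second moment of a time integral *)

Section second_moment.
Context (R : realType) (T : pmetricType R).
Variables (P : R.-pker (borel T) ~> (cadlag_path T)) (mu : probability (borel T) R).
Hypotheses (FP : feller_process P) (IP : invariant_law mu P).
Local Notation path := (cadlag_path T).
Local Notation leb := (@lebesgue_measure R).
Local Notation law := (law_from mu P).
Variable f : borel T -> R.
Hypothesis mf : measurable_fun setT f.
Hypothesis if2 : mu.-integrable setT (fun x => (f x ^+ 2)%:E).
Variable tau : R.
Hypothesis tau_ge0 : 0 <= tau.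

Local Notation rho := (correlation P mu f).
Local Notation D := (`[0, tau]%classic : set R).

Let obs := observed f.
Let mobs : measurable_fun setT obs. Proof. exact: measurable_observed. Qed.
Let mobs_at t : measurable_fun setT (fun w : path => obs (t, w)).
Proof. exact: measurable_observed_at. Qed.

Let mD : measurable D. Proof. exact: measurable_itv. Qed.

Definition path_integral (w : path) : R := \int[leb]_(s in `[0, tau]) f (w s).

Let path_integralE w : path_integral w = \int[leb]_(s in D) obs (s, w).
Proof.
apply: eq_Rintegral => s; rewrite mem_setE in_itv/= => /andP[s0 _].
by rewrite /obs observedE.
Qed.

Lemma measurable_path_integral : measurable_fun setT path_integral.
Proof.
have := measurable_Rintegral_param leb mD mobs.
by congr measurable_fun; apply/funext => w; rewrite path_integralE.
Qed.

Let integrable_seg (c : R) : leb.-integrable D (EFin \o cst c).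
Proof.
apply: measurable_bounded_integrable => //; last exact: bounded_cst.
by rewrite /= lebesgue_measure_itv/=; case: ifP => _; rewrite ?ltry// -EFinB ltry.
Qed.

(* This follows from a bound on the fourth moment; it makes the product of the
   observable and of its time integral integrable in time and path. *)
Hypothesis iI2 : law.-integrable setT (fun w => (path_integral w ^+ 2)%:E).

Let S : R := \int[mu]_x (f x ^+ 2).
Let V : R := \int[law]_w (path_integral w ^+ 2).

Let inner_integral s : 0 <= s -> s <= tau ->
  \int[law]_w (obs (s, w) * path_integral w) = \int[leb]_(r in D) rho (s - r).
Proof.
move=> s0 stau.
pose k (z : R * path) := obs (s, z.2) * obs z.
have mk : measurable_fun setT k.
  by apply: measurable_funM => //; exact: (measurableT_comp (mobs_at s) measurable_snd).
have ik : (leb \x law)%E.-integrable (D `*` setT) (EFin \o k).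
  apply: (@integrable_prodX_dominated _ _ _ _ _ leb law _ _ _ mk (cst (S + S))) => //.
  move=> r; rewrite /= in_itv/= => /andP[r0 _].
  under eq_integral do rewrite /k/= /obs !observedE//.
  exact: integral_abs_eval_mul_le.
transitivity (\int[law]_w \int[leb]_(r in D) k (r, w)).
  apply: eq_Rintegral => w _; rewrite path_integralE -RintegralZl_measurable//.
  by apply: measurable_funTS; exact: measurableT_comp mobs (measurable_pair2 w).
rewrite -(Rintegral_fubini _ _ ik)//; apply: eq_Rintegral => r.
rewrite mem_setE in_itv/= => /andP[r0 _].
rewrite -(correlation_two_point FP IP mf s0 r0).
by apply: eq_Rintegral => w _; rewrite /k/= /obs !observedE.
Qed.

(** Expand the square one factor at a time: exchanging the expectation with
    the first time integral, then with the second, leaves the double integral of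
    correlation (s - r). *)
Lemma second_moment_path_integral (M : R) : (forall u, `|rho u| <= M) ->
  \int[law]_w (path_integral w ^+ 2) =
  2 * \int[leb]_(s in `[0, tau]) primitive rho s.
Proof.
move=> rhoM; have mI := measurable_path_integral.
pose k (z : R * path) := obs z * path_integral z.2.
have mk : measurable_fun setT k.
  by apply: measurable_funM => //; exact: (measurableT_comp mI measurable_snd).
have ik : (leb \x law)%E.-integrable (D `*` setT) (EFin \o k).
  apply: (@integrable_prodX_dominated _ _ _ _ _ leb law _ _ _ mk (cst (S + V))) => //.
  move=> s; rewrite /= in_itv/= => /andP[s0 _].
  have E1 : (\int[law]_w (f (w s) ^+ 2)%:E = S%:E)%E.
    by rewrite integral_sqr_eval// fineK//; exact: integrable_fin_num.
  have E2 : (\int[law]_w (path_integral w ^+ 2)%:E = V%:E)%E.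
    by rewrite fineK//; exact: integrable_fin_num.
  have mI2 : measurable_fun setT (fun w => (path_integral w ^+ 2)%:E).
    exact: measurable_int iI2.
  have mf2 : measurable_fun setT (fun w : path => (f (w s) ^+ 2)%:E).
    exact: measurable_int (integrable_sqr_eval IP mf if2 s0).
  rewrite EFinD -E1 -E2 -ge0_integralD//; try by move=> w _; rewrite lee_fin sqr_ge0.
  apply: ge0_le_integral => //.
  - apply/measurable_EFinP; apply: measurableT_comp => //.
    exact: measurableT_comp mk (measurable_pair1 s).
  - exact: emeasurable_funD.
  move=> w _; rewrite /k /= /obs observedE// -EFinD lee_fin normrM.
  rewrite -(real_normK (num_real (f (w s)))) -(real_normK (num_real (path_integral w))).
  have := sqr_ge0 (`|f (w s)| - `|path_integral w|).
  by have := normr_ge0 (f (w s)); have := normr_ge0 (path_integral w); nra.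
transitivity (\int[law]_w \int[leb]_(s in D) k (s, w)).
  apply: eq_Rintegral => w _; rewrite expr2 {1}path_integralE mulrC.
  rewrite -RintegralZl_measurable//; first by apply: eq_Rintegral => s _; rewrite mulrC.
  by apply: measurable_funTS; exact: measurableT_comp mobs (measurable_pair2 w).
rewrite -(Rintegral_fubini _ _ ik)//.
rewrite -(double_integral_even_kernel (measurable_correlation _ _ mf) _ rhoM)//; last first.
  exact: correlation_even.
apply: eq_Rintegral => s; rewrite mem_setE in_itv/= => /andP[s0 stau].
exact: inner_integral.
Qed.

End second_moment.

(** * Sample means of independent copies *)

Section independent_sampling.
Context d d' (Omega : measurableType d) (E : measurableType d') (R : realType).
Variables (Q : probability Omega R) (m : probability E R).
Variable X : nat -> {RV Q >-> E}.
Hypothesis law_X : forall k (A : set E), measurable A -> distribution Q (X k) A = m A.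
Hypothesis indep : mutually_independent X.
Variable psi : E -> R.
Hypothesis mpsi : measurable_fun setT psi.
Hypothesis ipsi2 : m.-integrable setT (fun x => (psi x ^+ 2)%:E).

Let mean : R := \int[m]_x psi x.
Let second : R := \int[m]_x (psi x ^+ 2).

Let mX k : measurable_fun setT (X k : Omega -> E).
Proof. exact: measurable_funPT. Qed.

Let same_law_X k (A : set E) : measurable A -> Q ((X k : Omega -> E) @^-1` A) = m (id @^-1` A).
Proof. by move=> mA; exact: law_X. Qed.

Let ipsi : m.-integrable setT (EFin \o psi).
Proof.
have : m.-integrable setT (fun x => (psi x * 1)%:E).
  apply: (@integrable_prod_sqr _ E R m setT psi (fun=> 1)) => //.
  by rewrite expr1n; exact: finite_measure_integrable_cst.
by congr is_true; congr integrable; apply/funext => w /=; rewrite mulr1.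
Qed.

Lemma pair_law_independent i j : i != j -> forall C : set (E * E), measurable C ->
  Q ((fun w => (X i w, X j w)) @^-1` C) = (m \x m)%E (id @^-1` C).
Proof.
move=> ij; apply: (same_law_generated _ _ (measurable_prod_rectangles E E)
  (@setI_closed_rectangles _ _ E E)).
- by apply: measurable_fun_pair.
- exact: measurable_id.
- by exists setT => //; exists setT => //; rewrite setXTT.
- by rewrite (le_lt_trans (probability_le1 _ _))// ltry.
move=> _ [A mA [B mB <-]]; rewrite preimage_id [RHS]product_measure1E//.
have := @indep [:: i; j] (fun k => if k == i then A else B).
rewrite !big_cons !big_nil /= eqxx eq_sym (negbTE ij) setIT mule1 => ->.
- by rewrite !same_law_X.
- by rewrite inE ij.
- by move=> k; case: ifP.
Qed.

Let measurable_psi2 : measurable_fun [set: E * E] (fun z => psi z.1 * psi z.2).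
Proof.
by apply: measurable_funM; apply: (measurableT_comp mpsi);
  [exact: measurable_fst|exact: measurable_snd].
Qed.

Lemma integral_independent_product i j : i != j ->
  \int[Q]_w (psi (X i w) * psi (X j w)) = mean ^+ 2.
Proof.
move=> ij.
have mp : measurable_fun setT (fun w => (X i w, X j w)) by exact: measurable_fun_pair.
have := Rintegral_same_law mp (@measurable_id _ _ _) (pair_law_independent ij) measurable_psi2.
move=> ->.
pose B : R := \int[m]_x `|psi x|.
have BE : (\int[m]_x `|psi x|%:E = B%:E)%E.
  by rewrite fineK//; apply: integrable_fin_num => //; exact: (integrable_abse ipsi).
have i2 : (m \x m)%E.-integrable setT (EFin \o (fun z : E * E => psi z.1 * psi z.2)).
  rewrite -setXTT; apply: (@integrable_prodX_dominated _ _ _ _ _ m m setT _ _ measurable_psi2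
    (fun x => B * `|psi x|)) => //.
    have -> : EFin \o (fun x => B * `|psi x|) = (fun x => B%:E * (abse \o (EFin \o psi)) x)%E.
      by apply/funext => x /=; rewrite EFinM.
    by apply: integrableZl => //; exact: integrable_abse.
  move=> x _; under eq_integral do rewrite /= normrM EFinM.
  rewrite ge0_integralZl//; first by rewrite BE -EFinM lee_fin mulrC.
  by apply/measurable_EFinP; exact: measurableT_comp.
rewrite /Rintegral -(integral12_prod_meas1 i2) -integral_fine//; last first.
  exact: integrable_fubini_F i2.
transitivity (\int[m]_x (psi x * mean)).
  apply: eq_Rintegral => x _.
  rewrite -[LHS]/(\int[m]_y (psi x * psi y)).
  by rewrite RintegralZl_measurable.
by rewrite expr2 RintegralZr.
Qed.

Lemma integral_identical_sqr k : \int[Q]_w (psi (X k w) ^+ 2) = second.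
Proof.
exact: (Rintegral_same_law (mX k) (@measurable_id _ _ _) (same_law_X k)
  (measurable_funX 2 mpsi)).
Qed.

Let mpX k : measurable_fun setT (fun w => psi (X k w)).
Proof. exact: measurableT_comp. Qed.

Let ipX k : Q.-integrable setT (fun w => (psi (X k w) ^+ 2)%:E).
Proof.
apply: (@integrable_same_law _ _ _ Omega E E R Q m (X k) id (mX k) (@measurable_id _ _ _)
  (same_law_X k) (fun x => (psi x ^+ 2)%:E)) => //.
by apply/measurable_EFinP; exact: measurable_funX.
Qed.

Let sum n w := \sum_(1 <= k < n.+1) psi (X k w).

Let sum0 w : sum 0 w = 0.
Proof. by rewrite /sum big_geq. Qed.

Let sumS n w : sum n.+1 w = sum n w + psi (X n.+1 w).
Proof. by rewrite /sum big_nat_recr. Qed.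

Let msum n : measurable_fun setT (sum n).
Proof. by apply: measurable_sum. Qed.

Let sqrS n : (fun w => (sum n.+1 w ^+ 2)%:E) = (fun w =>
  ((sum n w ^+ 2)%:E + (2 * (sum n w * psi (X n.+1 w)))%:E) + (psi (X n.+1 w) ^+ 2)%:E)%E.
Proof. by apply/funext => w; rewrite sumS -!EFinD; congr EFin; ring. Qed.

Let isum n : Q.-integrable setT (fun w => (sum n w ^+ 2)%:E).
Proof.
elim: n => [|n IH].
  have -> : (fun w => (sum 0 w ^+ 2)%:E) = cst 0%E.
    by apply/funext => w; rewrite sum0 expr0n.
  exact: integrable0.
rewrite sqrS; apply: integrableD => //; apply: integrableD => //.
under [X in _.-integrable _ X]eq_fun do rewrite EFinM.
apply: integrableZl => //; exact: integrable_prod_sqr.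
Qed.

Let icross n k : Q.-integrable setT (fun w => (sum n w * psi (X k w))%:E).
Proof. exact: integrable_prod_sqr. Qed.

(* Independence enters only here, and only pairwise. *)
Let cross n k : (n < k)%N -> \int[Q]_w (sum n w * psi (X k w)) = n%:R * mean ^+ 2.
Proof.
elim: n => [|n IH] nk.
  rewrite mul0r (@eq_Rintegral _ Omega R Q setT (cst 0)); last by move=> w _; rewrite sum0 mul0r.
  by rewrite Rintegral_cst// mul0r.
rewrite (@eq_Rintegral _ Omega R Q setT
  (fun w => sum n w * psi (X k w) + psi (X n.+1 w) * psi (X k w))).
  rewrite (RintegralD measurableT (icross n k)
    (integrable_prod_sqr measurableT (mpX _) (mpX _) (ipX _) (ipX _))).
  rewrite IH ?(ltnW nk)// integral_independent_product ?(ltn_eqF nk)//.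
  by rewrite -natr1; ring.
by move=> w _; rewrite sumS mulrDl.
Qed.

Lemma second_moment_sum n :
  \int[Q]_w (sum n w ^+ 2) = n%:R * (second - mean ^+ 2) + n%:R ^+ 2 * mean ^+ 2.
Proof.
elim: n => [|n IH].
  rewrite (@eq_Rintegral _ Omega R Q setT (cst 0)); last by move=> w _; rewrite sum0 expr0n.
  by rewrite Rintegral_cst//; ring.
rewrite (@eq_Rintegral _ Omega R Q setT (fun w => sum n w ^+ 2 + 2 * (sum n w * psi (X n.+1 w)) +
  psi (X n.+1 w) ^+ 2)); last by move=> w _; rewrite sumS; ring.
have i2 : Q.-integrable setT (EFin \o (fun w => 2 * (sum n w * psi (X n.+1 w)))).
  have -> : EFin \o (fun w => 2 * (sum n w * psi (X n.+1 w))) =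
    (fun w => 2%:E * (sum n w * psi (X n.+1 w))%:E)%E by apply/funext => w /=; rewrite EFinM.
  exact: integrableZl.
rewrite (RintegralD measurableT (integrableD measurableT (isum n) i2) (ipX n.+1)).
rewrite (RintegralD measurableT (isum n) i2).
rewrite (RintegralZl _ measurableT (icross n n.+1)) IH cross//.
rewrite integral_identical_sqr -natr1.
by ring.
Qed.

(** Variance over N plus squared mean; applied to psi minus a target value, it is
    the decomposition of the mean square error into variance and squared bias. *)
Lemma integral_sample_mean_sqr N : (0 < N)%N ->
  (\int[Q]_w ((N%:R^-1 * \sum_(1 <= k < N.+1) psi (X k w)) ^+ 2)%:E =
   (N%:R^-1 * (second - mean ^+ 2) + mean ^+ 2)%:E)%E.
Proof.
move=> N0; have N0' : N%:R != 0 :> R by rewrite pnatr_eq0 -lt0n.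
under eq_integral do rewrite exprMn EFinM.
rewrite integralZl//; last exact: isum.
rewrite -(fineK (integrable_fin_num measurableT (isum N))) -EFinM; congr EFin.
by have := second_moment_sum N; rewrite /Rintegral => ->; field.
Qed.

End independent_sampling.

(** * The extrapolated estimator *)

Section richardson_summand.
Context (R : realType) (T : pmetricType R).
Variables (P : R.-pker (borel T) ~> (cadlag_path T)) (mu : probability (borel T) R).
Hypotheses (FP : feller_process P) (IP : invariant_law mu P).
Local Notation path := (cadlag_path T).
Local Notation leb := (@lebesgue_measure R).
Local Notation law := (law_from mu P).
Variable f : borel T -> R.
Hypothesis mf : measurable_fun setT f.
Hypothesis if2 : mu.-integrable setT (fun x => (f x ^+ 2)%:E).
Hypothesis fourth : forall t, 1 <= t ->
  (\int[law]_w (normalized_integral f t w ^+ 4)%:E <= 1)%E.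

Lemma measurable_normalized_integral t :
  measurable_fun setT (normalized_integral f t : path -> R).
Proof. by apply: measurable_funM => //; exact: measurable_path_integral. Qed.

Let mni := measurable_normalized_integral.

Lemma integrable_normalized_integral4 t : 1 <= t ->
  law.-integrable setT (fun w => (normalized_integral f t w ^+ 4)%:E).
Proof.
move=> t1; apply/integrableP; split.
  by apply/measurable_EFinP; exact: measurable_funX.
under eq_integral do rewrite gee0_abs ?lee_fin ?exprn_even_ge0//.
exact: le_lt_trans (fourth t1) (ltry _).
Qed.

Lemma integrable_normalized_integral2 t : 1 <= t ->
  law.-integrable setT (fun w => (normalized_integral f t w ^+ 2)%:E).
Proof.
move=> t1.
have : law.-integrable setT (fun w => (normalized_integral f t w ^+ 2 * 1)%:E).
  apply: (@integrable_prod_sqr _ path R law setT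
    (fun w => normalized_integral f t w ^+ 2) (fun=> 1)) => //.
  - exact: measurable_funX.
  - under eq_fun do rewrite -exprM; exact: integrable_normalized_integral4.
  - by rewrite expr1n; exact: finite_measure_integrable_cst.
by congr is_true; congr integrable; apply/funext => w /=; rewrite mulr1.
Qed.

Lemma integral_normalized_integral2 t (M : R) : 1 <= t ->
  (forall u, `|correlation P mu f u| <= M) ->
  \int[law]_w (normalized_integral f t w ^+ 2) =
  t^-1 * (2 * \int[leb]_(s in `[0, t]) primitive (correlation P mu f) s).
Proof.
move=> t1 rM; have t0 : 0 < t by apply: lt_le_trans t1.
have sq w : path_integral f t w ^+ 2 = t * normalized_integral f t w ^+ 2.
  rewrite /normalized_integral -/(path_integral f t w) exprMn exprVn sqr_sqrtr ?ltW//.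
  by rewrite mulrA mulfV ?mul1r// gt_eqF.
rewrite -(second_moment_path_integral FP IP mf if2 (ltW t0) _ rM); last first.
  under eq_fun do rewrite sq EFinM.
  by apply: integrableZl => //; exact: integrable_normalized_integral2.
under [in RHS]eq_Rintegral do rewrite sq.
rewrite (RintegralZl _ measurableT (integrable_normalized_integral2 t1)) mulrA.
by rewrite mulVf ?mul1r// gt_eqF.
Qed.

(** One summand of the extrapolated estimator. The combination of the horizons
    2 t and t is the one that eliminates a bias proportional to 1 / t. *)
Definition richardson (t : R) (w : path) : R :=
  2 * normalized_integral f (2 * t) w ^+ 2 - normalized_integral f t w ^+ 2.

Lemma measurable_richardson t : measurable_fun setT (richardson t).
Proof.
apply: measurable_funB; last exact: measurable_funX.
by apply: measurable_funM => //; exact: measurable_funX.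
Qed.

Let richardson_sqr_le t w : richardson t w ^+ 2 <=
  8 * normalized_integral f (2 * t) w ^+ 4 + 2 * normalized_integral f t w ^+ 4.
Proof.
rewrite /richardson.
move: (normalized_integral f (2 * t) w) (normalized_integral f t w) => a b.
(* (x - y)^2 + (x + y)^2 = 2 x^2 + 2 y^2 with x = 2 a^2 and y = b^2 *)
have -> : 8 * a ^+ 4 + 2 * b ^+ 4 =
    (2 * a ^+ 2 - b ^+ 2) ^+ 2 + (2 * a ^+ 2 + b ^+ 2) ^+ 2 by ring.
by rewrite lerDl sqr_ge0.
Qed.

Let bound_integrable t : 1 <= t -> law.-integrable setT (EFin \o (fun w =>
  8 * normalized_integral f (2 * t) w ^+ 4 + 2 * normalized_integral f t w ^+ 4)).
Proof.
move=> t1; have t2 : 1 <= 2 * t by lra.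
have -> : EFin \o (fun w => 8 * normalized_integral f (2 * t) w ^+ 4 +
    2 * normalized_integral f t w ^+ 4) =
  (fun w => 8%:E * (normalized_integral f (2 * t) w ^+ 4)%:E +
    2%:E * (normalized_integral f t w ^+ 4)%:E)%E.
  by apply/funext => w; rewrite /= EFinD !EFinM.
by apply: integrableD => //; apply: integrableZl => //; exact: integrable_normalized_integral4.
Qed.

Lemma integrable_richardson_sqr t : 1 <= t ->
  law.-integrable setT (fun w => (richardson t w ^+ 2)%:E).
Proof.
move=> t1; apply: (le_integrable measurableT _ _ (bound_integrable t1)).
  by apply/measurable_EFinP; apply: measurable_funX; exact: measurable_richardson.
move=> w _; rewrite /= lee_fin ger0_norm ?sqr_ge0// (le_trans (richardson_sqr_le t w))//.
exact: ler_norm.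
Qed.

Lemma integral_richardson_sqr_le t : 1 <= t ->
  \int[law]_w (richardson t w ^+ 2) <= 10.
Proof.
move=> t1; have t2 : 1 <= 2 * t by lra.
apply: le_trans (le_Rintegral measurableT (integrable_richardson_sqr t1)
  (bound_integrable t1) (fun w _ => richardson_sqr_le t w)) _.
have le4 s : 1 <= s -> \int[law]_w (normalized_integral f s w ^+ 4) <= 1.
  move=> s1; rewrite -lee_fin fineK; first exact: fourth.
  exact: (integrable_fin_num measurableT (integrable_normalized_integral4 s1)).
have i4 s c : 1 <= s -> law.-integrable setT
    (EFin \o (fun w => c * normalized_integral f s w ^+ 4)).
  move=> s1; have -> : EFin \o (fun w => c * normalized_integral f s w ^+ 4) =
    (fun w => c%:E * (normalized_integral f s w ^+ 4)%:E)%E.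
    by apply/funext => w; rewrite /= EFinM.
  by apply: integrableZl => //; exact: integrable_normalized_integral4.
rewrite (RintegralD measurableT (i4 _ 8 t2) (i4 _ 2 t1)).
rewrite (RintegralZl _ measurableT (integrable_normalized_integral4 t2)).
rewrite (RintegralZl _ measurableT (integrable_normalized_integral4 t1)).
have := le4 _ t1; have := le4 _ t2.
move: (\int[law]_w (normalized_integral f (2 * t) w ^+ 4)).
by move: (\int[law]_w (normalized_integral f t w ^+ 4)) => a b; lra.
Qed.

Lemma integral_richardson t (M : R) : 1 <= t ->
  (forall u, `|correlation P mu f u| <= M) ->
  \int[law]_w richardson t w =
  2 / t * (\int[leb]_(s in `[0, 2 * t]) primitive (correlation P mu f) s -
           \int[leb]_(s in `[0, t]) primitive (correlation P mu f) s).
Proof.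
move=> t1 rM; have t2 : 1 <= 2 * t by lra.
have i2 : law.-integrable setT
    (EFin \o (fun w => 2 * normalized_integral f (2 * t) w ^+ 2)).
  have -> : EFin \o (fun w => 2 * normalized_integral f (2 * t) w ^+ 2) =
    (fun w => 2%:E * (normalized_integral f (2 * t) w ^+ 2)%:E)%E.
    by apply/funext => w; rewrite /= EFinM.
  by apply: integrableZl => //; exact: integrable_normalized_integral2.
rewrite (RintegralB measurableT i2 (integrable_normalized_integral2 t1)).
rewrite (RintegralZl _ measurableT (integrable_normalized_integral2 t2)).
rewrite (integral_normalized_integral2 t2 rM) (integral_normalized_integral2 t1 rM).
by field; rewrite gt_eqF//; lra.
Qed.

End richardson_summand.

Lemma hsigma2_1_sample_mean (R : realType) (T : pmetricType R) d
    (Omega : measurableType d) (X : nat -> Omega -> cadlag_path T) N t f omega :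
  hsigma2_1 X N t f omega =
  N%:R^-1 * \sum_(1 <= k < N.+1) richardson f t (X k omega).
Proof.
rewrite /hsigma2_1 /hsigma2_0 mulrCA -mulrBr mulr_sumr -sumrB.
by [].
Qed.

Lemma sample_mean_sub (R : realType) N (a : nat -> R) (c : R) : (0 < N)%N ->
  N%:R^-1 * \sum_(1 <= k < N.+1) a k - c =
  N%:R^-1 * \sum_(1 <= k < N.+1) (a k - c).
Proof.
move=> N0; rewrite sumrB big_const_nat iter_addr_0 subn1 /= mulrBr.
by rewrite -(mulr_natl c N) mulrA mulVf ?mul1r// pnatr_eq0 -lt0n.
Qed.

(** A mean square error bounded by a variance 10 / N plus a squared bias has
    a square root bounded by the sum of the two rates; 4 is a rational bound for
    sqrt 10. *)
Lemma sqrt_sum_sqr_le (R : realType) (alpha : R) (t e b : R) (N : nat) :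
  1 < alpha -> (0 < N)%N -> 0 <= e -> e <= N%:R^-1 * 10 + b ^+ 2 ->
  `|b| <= 2 / (alpha - 1) * t `^ (- (alpha - 1)) ->
  e `^ 2^-1 <= (4 + 2 / (alpha - 1)) *
    (N%:R `^ (- 2^-1) + t `^ (- (alpha - 1))).
Proof.
move=> a1 N0 e0 eb bt.
have a0 : 0 < (alpha - 1)^-1 by rewrite invr_gt0 subr_gt0.
have x2 : (N%:R `^ (- 2^-1)) ^+ 2 = N%:R^-1 :> R.
  by rewrite powRN exprVn powR12_sqrt// sqr_sqrtr.
move: x2; have := powR_ge0 (N%:R : R) (- 2^-1); set x := _ `^ _ => x0 x2.
move: bt; have := powR_ge0 t (- (alpha - 1)); set y := t `^ _ => y0 bt.
set c := (alpha - 1)^-1 in a0 bt *.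
have z0 : 0 <= (4 + 2 * c) * (x + y) by rewrite mulr_ge0 ?addr_ge0// mulr_ge0// ltW.
rewrite powR12_sqrt// -(ger0_norm z0) -sqrtr_sqr ler_sqrt ?sqr_ge0//.
have b2 : b ^+ 2 <= (2 * c * y) ^+ 2.
  by rewrite -real_normK ?num_real// ler_sqr ?nnegrE// !mulr_ge0// ltW.
have zle : 4 * x + 2 * c * y <= (4 + 2 * c) * (x + y).
  rewrite -subr_ge0 (_ : _ - _ = 4 * y + 2 * (c * x)); last by ring.
  by rewrite addr_ge0// !mulr_ge0// ltW.
have cy0 : 0 <= c * y by rewrite mulr_ge0// ltW.
apply: (@le_trans _ _ ((4 * x + 2 * c * y) ^+ 2)); last first.
  by rewrite ler_sqr ?nnegrE// -mulrA; lra.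
apply: le_trans eb _; rewrite -x2; apply: le_trans (lerD (lexx _) b2) _.
rewrite -subr_ge0 (_ : _ - _ = 6 * x ^+ 2 + 16 * (x * (c * y))); last by ring.
have xcy0 : 0 <= x * (c * y) by rewrite mulr_ge0.
by have := sqr_ge0 x; lra.
Qed.

(** * The mean square error *)

Theorem proposition4p2 (R : realType) (alpha : R) (alpha_gt1 : 1 < alpha) :
  exists C : R,
  forall (T : pmetricType R)
    (P : R.-pker (borel T) ~> (cadlag_path T))
    (mu : probability (borel T) R)
    (d : measure_display) (Omega : measurableType d) (Q : probability Omega R)
    (X : nat -> {RV Q >-> cadlag_path T}),
  feller_process P ->
  invariant_law mu P ->
  (forall k (A : set (cadlag_path T)), measurable A ->
     distribution Q (X k) A = law_from mu P A) ->
  mutually_independent X ->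
  forall f : borel T -> R,
  f \in Lfun mu 2%:E ->
  ('E_mu[f] = 0)%E ->
  (forall t : R, 0 <= t ->
     `|inner mu f (semigroup P t f)| <= (1 + t) `^ (- alpha)) ->
  (ereal_sup [set 'E_(law_from mu P)[fun w => (normalized_integral f t w ^+ 4)%R]
             | t in [set t : R | (1 <= t)%R]] <= 1)%E ->
  forall (t : R) (N : nat), 2 <= t -> (0 < N)%N ->
  ('E_Q[fun omega => ((hsigma2_1 X N t f omega - sigma2 mu P f) ^+ 2)%R] `^ 2^-1
   <= (C * (N%:R `^ (- 2^-1) + t `^ (- (alpha - 1))))%R%:E)%E.
Proof.
exists (4 + 2 / (alpha - 1)).
move=> T P mu d Omega Q X FP IP law_X indep f Lf _ decay fourth_sup t N t2 N0.
have mf : measurable_fun setT f.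
  by move: Lf; rewrite inE => /andP[/[!inE]/= mf _].
have if2 : mu.-integrable setT (fun x => (f x ^+ 2)%:E) := Lfun2_integrable_sqr Lf.
have fourth s : 1 <= s ->
    (\int[law_from mu P]_w (normalized_integral f s w ^+ 4)%:E <= 1)%E.
  move=> s1; apply: le_trans fourth_sup; apply: ereal_sup_ubound.
  by exists s => //; rewrite unlock.
have t1 : 1 <= t by lra.
have t0 : 0 < t by lra.
pose c := sigma2 mu P f; pose psi w := richardson f t w - c.
have mY : measurable_fun setT (richardson f t : cadlag_path T -> R).
  exact: measurable_richardson.
have iY2 := integrable_richardson_sqr mf fourth t1.
have iY : (law_from mu P).-integrable setT (EFin \o richardson f t).
  have : (law_from mu P).-integrable setT (fun w => (richardson f t w * 1)%:E).
    apply: (@integrable_prod_sqr _ _ R (law_from mu P) setT (richardson f t) (fun=> 1)) => //.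
    by rewrite expr1n; exact: finite_measure_integrable_cst.
  by congr is_true; congr integrable; apply/funext => w /=; rewrite mulr1.
have iZ a : (law_from mu P).-integrable setT (EFin \o cst a).
  exact: finite_measure_integrable_cst.
have iaY a : (law_from mu P).-integrable setT (EFin \o (fun w => a * richardson f t w)).
  have -> : EFin \o (fun w => a * richardson f t w) =
    (fun w => a%:E * (EFin \o richardson f t) w)%E by apply/funext => w; rewrite /= EFinM.
  exact: integrableZl.
have psi2E w : psi w ^+ 2 =
    richardson f t w ^+ 2 + - (2 * c) * richardson f t w + c ^+ 2.
  by rewrite /psi; ring.
have i12 := integrableD measurableT iY2 (iaY (- (2 * c))).
have ipsi2 : (law_from mu P).-integrable setT (fun w => (psi w ^+ 2)%:E).
  have := integrableD measurableT i12 (iZ (c ^+ 2)).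
  by congr is_true; congr integrable; apply/funext => w /=; rewrite psi2E.
have mpsi : measurable_fun setT (psi : cadlag_path T -> R) by exact: measurable_funB.
have mean_cst a : \int[law_from mu P]_w (cst a w) = a.
  have := Rintegral_cst (law_from mu P) measurableT a.
  have /(congr1 fine) /= -> : law_from mu P setT = 1%E by exact: probability_setT.
  by rewrite mulr1.
have Epsi : \int[law_from mu P]_w psi w = \int[law_from mu P]_w richardson f t w - c.
  by rewrite (RintegralB measurableT iY (iZ c)) mean_cst.
have Epsi2 : \int[law_from mu P]_w (psi w ^+ 2) =
    \int[law_from mu P]_w (richardson f t w ^+ 2) +
    - (2 * c) * \int[law_from mu P]_w richardson f t w + c ^+ 2.
  under eq_Rintegral do rewrite psi2E.
  rewrite (RintegralD measurableT i12 (iZ (c ^+ 2))) mean_cst.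
  by rewrite (RintegralD measurableT iY2 (iaY _)) (RintegralZl _ measurableT iY).
have rho1 := correlation_le1 FP IP mf if2 alpha_gt1 decay.
have bias := average_primitive_bias FP IP mf if2 alpha_gt1 decay t0.
rewrite -(integral_richardson FP IP mf if2 fourth t1 rho1) in bias.
rewrite -(sigma2_correlation FP IP mf if2 alpha_gt1 decay) -/c -Epsi in bias.
have errE w : (hsigma2_1 X N t f w - sigma2 mu P f) ^+ 2 =
    (N%:R^-1 * \sum_(1 <= k < N.+1) psi (X k w)) ^+ 2.
  by rewrite hsigma2_1_sample_mean (sample_mean_sub _ _ N0).
rewrite unlock; under eq_integral do rewrite errE.
have mse := integral_sample_mean_sqr law_X indep mpsi ipsi2 N0.
have mse0 : (0 <= \int[Q]_w ((N%:R^-1 * \sum_(1 <= k < N.+1) psi (X k w)) ^+ 2)%:E)%E.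
  by apply: integral_ge0 => w _; rewrite lee_fin sqr_ge0.
rewrite [X in (X `^ _)%E]mse poweR_EFin lee_fin.
apply: sqrt_sum_sqr_le bias => //; first by rewrite -lee_fin -mse.
rewrite lerD2r ler_wpM2l ?invr_ge0//.
rewrite Epsi2 Epsi; have := integral_richardson_sqr_le mf fourth t1.
have := sqr_ge0 (\int[law_from mu P]_w richardson f t w).
move: (\int[law_from mu P]_w (richardson f t w ^+ 2)) (\int[law_from mu P]_w richardson f t w).
by move=> a b; nra.
Qed.
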